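(* Let $D=\left(\frac{a,b}{K}\right)$ be a quaternion division algebra over $K$ with $a,b\in\mathcal{O}_K^*$, with $K$-basis $1,x,y,z$ where $x^2=a$, $y^2=b$, $z=xy=-yx$, and let $\tau$ be its canonical (symplectic) involution. Take $\epsilon=-1$, $\sigma=\tau$ and $\pi'=\pi x$, so that $\sigma_{\pi'}=\tau_{\pi'}=\tau_x$ is an orthogonal involution. Then Larmour's isomorphism $\partial=(\partial_0,\partial_1)$ is an isomorphism $$W^{-1}\left(\left(\tfrac{a,b}{K}\right),\tau\right)\cong W^{-1}\left(\left(\tfrac{\overline a,\overline b}{k}\right),\overline\tau\right)\oplus W^{1}\left(\left(\tfrac{\overline a,\overline b}{k}\right),\overline{\tau_x}\right).$$ Here $Sym^{-1}\left(\left(\frac{a,b}{K}\right),\tau\right)$ is the $K$-span of $x,y,z$, $Sym^{-1}\left(\left(\frac{\overline a,\overline b}{k}\right),\overline\tau\right)$ is the $k$-span of $\overline x,\overline y,\overline z$, and $Sym^{1}\left(\left(\frac{\overline a,\overline b}{k}\right),\overline{\tau_x}\right)$ is the $k$-span of $\overline 1,\overline y,\overline z$. On one-dimensional forms the isomorphism is given as follows. The image of any one-dimensional unramified skew-hermitian form $\langle\alpha x+\beta y+\gamma z\rangle$ (where $\alpha,\beta,\gamma\in\mathcal{O}_K$ and $\alpha x+\beta y+\gamma z\in\mathcal{O}_D^*$) under $\partial_0$ is $\langle\overline{\alpha x+\beta y+\gamma z}\rangle$. The image of any one-dimensional ramified skew-hermitian form $\langle\alpha x+\beta y+\gamma z\rangle$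 (where $\alpha,\beta,\gamma\in m_K$ and $\nu_D(\alpha x+\beta y+\gamma z)=1$) under $\partial_1$ is $\langle\overline{\pi^{-1}(\alpha-\gamma y+\beta z)}\rangle$.
   Context: $K$ is a complete discretely valued field with valuation $\nu_K:K\setminus\{0\}\to\mathbb{Z}$, ring of integers $\mathcal{O}_K$, maximal ideal $m_K$, uniformizer $\pi$ and residue field $k$ of characteristic $\neq2$. The valuation $\nu_D(d)=\frac12\nu_K(\mathrm{Nrd}(d))$ is the unique extension of $\nu_K$ to $D$; $\mathcal{O}_D=\{\nu_D\ge0\}$, $m_D=\{\nu_D>0\}$ (both with $0$), $\overline D=\mathcal{O}_D/m_D$, and a bar denotes reduction modulo $m_D$. When $a,b$ are units, $\overline D\cong\left(\frac{\overline a,\overline b}{k}\right)$, a quaternion division algebra, and $\nu_D$ has value group $\mathbb{Z}$. Every involution $\sigma$ of the first kind on $D$ preserves $\mathcal{O}_D$ and $m_D$ and induces an involution $\overline\sigma$ on $\overline D$. The canonical involution satisfies $\tau(x)=-x$, $\tau(y)=-y$, $\tau(z)=-z$. For $\lambda\in D^*$, $\sigma_\lambda(d)=\lambda\sigma(d)\lambda^{-1}$. For $\epsilon\in\{1,-1\}$ and a division algebra with involution $(E,\rho)$, $Sym^{\epsilon}(E,\rho)=\{e\in E:\rho(e)=\epsilon e\}$ is the set of $\epsilon$-symmetric elements, $W^\epsilon(E,\rho)$ is the Witt group of $\epsilon$-hermitian forms over $(E,\rho)$ (hermitian for $\epsilon=1$, skew-hermitian for $\epsilon=-1$), and $\langle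 u_1,\dots,u_r\rangle$ is the diagonal form with $u_i\in Sym^{\epsilon}(E,\rho)$. Larmour's isomorphism: given an $\epsilon$-symmetric uniformizer $\pi'$ of $D$ (i.e. $\sigma(\pi')=\epsilon\pi'$ and $\nu_D(\pi')$ is the least positive value of $\nu_D$), every $\epsilon$-hermitian form over $(D,\sigma)$ is isometric to some $h=h_0\perp h_1$ with $h_0=\langle u_1,\dots,u_p\rangle$, $\nu_D(u_i)=0$ (unramified), and $h_1=\langle v_1,\dots,v_q\rangle$, $\nu_D(v_i)=\nu_D(\pi')$ (ramified); if $h$ is anisotropic, then $h_0$ and $h_1$ are anisotropic and unique up to isometry. Set $\overline{h_0}=\langle\overline{u_1},\dots,\overline{u_p}\rangle$ and $\overline{h_1}=\langle\overline{v_1\pi'^{-1}},\dots,\overline{v_q\pi'^{-1}}\rangle$. Then $\partial=(\partial_0,\partial_1):W^\epsilon(D,\sigma)\to W^\epsilon(\overline D,\overline\sigma)\oplus W^1(\overline D,\overline{\sigma_{\pi'}})$, $[h]\mapsto([\overline{h_0}],[\overline{h_1}])$, is Larmour's group isomorphism.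
   Formalization: The printed ramified formula is false in general (K=Q((t)), a=-2, b=-1, α=β=t, γ=0); since yx^{-1}=-a^{-1}z, the image under ∂_1 is stated as the reduction of π^{-1}(α-γy-a^{-1}βz) instead of π^{-1}(α-γy+βz). *)

(* Defs.v *)
From HB Require Import structures.
From mathcomp Require Import all_boot all_order all_algebra all_field.
From mathcomp Require Import ring_quotient generic_quotient.
From mathcomp Require Import boolp.
From mathcomp Require Import ring.

Set Implicit Arguments.
Unset Strict Implicit.
Unset Printing Implicit Defensive.

Import Order.TTheory GRing.Theory Num.Theory.
Local Open Scope ring_scope.
Local Open Scope quotient_scope.

(* Only the values at nonzero arguments are meaningful. *)
Record dvaluation (K : fieldType) := DValuation {
  dval :> K -> int;
  dvalM : forall x y, x != 0 -> y != 0 -> dval (x * y) = dval x + dval y;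
  dvalD : forall x y, x != 0 -> y != 0 -> x + y != 0 ->
    Order.min (dval x) (dval y) <= dval (x + y);
  dval_surj : forall n : int, exists2 x, x != 0 & dval x = n
}.

Definition vcomplete (K : fieldType) (v : dvaluation K) : Prop :=
  let close (N : int) (x y : K) := x - y = 0 \/ N <= v (x - y) in
  forall u : nat -> K,
    (forall N, exists M, forall m n, (M <= m)%N -> (M <= n)%N ->
       close N (u m) (u n)) ->
    exists l, forall N, exists M, forall n, (M <= n)%N -> close N (u n) l.

Section ResidueField.
Variables (K : fieldType) (v : dvaluation K).

Definition vring : {pred K} := fun x => (x == 0) || (0 <= v x).
Definition vmax : {pred K} := fun x => (x == 0) || (0 < v x).
Definition vunit : {pred K} :=
  fun x => [&& x \is a GRing.unit, x \in vring & x^-1 \in vring].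
Definition vuniformizer : {pred K} := fun x => (x != 0) && (v x == 1).

Lemma dval1 : v 1 = 0.
Proof.
have := @dvalM K v 1 1 (oner_neq0 _) (oner_neq0 _).
by rewrite mulr1 => /eqP; rewrite -subr_eq subrr => /eqP <-.
Qed.

Lemma dvalN1 : v (- 1) = 0.
Proof.
have n0 : (- 1 : K) != 0 by rewrite oppr_eq0 oner_neq0.
have := dvalM v n0 n0; rewrite mulrNN mulr1 dval1 => /eqP.
by rewrite eq_sym -mulr2n mulrn_eq0 /= => /eqP.
Qed.

Lemma dvalV x : x != 0 -> v x^-1 = - v x.
Proof.
move=> x0; have := @dvalM K v x x^-1 x0; rewrite invr_eq0 => /(_ x0).
by rewrite divff // dval1 => /eqP; rewrite eq_sym addrC addr_eq0 => /eqP.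
Qed.

Lemma dvalN x : v (- x) = v x.
Proof.
have [->|x0] := eqVneq x 0; first by rewrite oppr0.
by rewrite -mulN1r dvalM ?oppr_eq0 ?oner_neq0 // dvalN1 add0r.
Qed.

Lemma vring_subring : subring_closed vring.
Proof.
split.
- by rewrite unfold_in dval1 lexx orbT.
- move=> x y; rewrite !unfold_in => hx hy.
  have [->|x0] := eqVneq x 0; first by rewrite add0r oppr_eq0 dvalN.
  have [->|y0] := eqVneq y 0; first by rewrite subr0.
  move: hx hy; rewrite (negPf x0) (negPf y0) /= => hx hy.
  have [//|xy0 /=] := eqVneq (x - y) 0.
  have := @dvalD K v x (- y) x0; rewrite oppr_eq0 dvalN => /(_ y0 xy0).
  by apply: le_trans; rewrite le_min hx.
- move=> x y; rewrite !unfold_in mulf_eq0.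
  have [//|x0] := eqVneq x 0; have [//|y0 /=] := eqVneq y 0.
  by move=> hx hy; rewrite dvalM // addr_ge0.
Qed.
HB.instance Definition _ := GRing.isSubringClosed.Build K vring vring_subring.

Record valring := Valring { valring_val :> K; _ : valring_val \in vring }.
HB.instance Definition _ := [isSub for valring_val].
HB.instance Definition _ := [Choice of valring by <:].
HB.instance Definition _ := [SubChoice_isSubComNzRing of valring by <:].

Definition maxideal : {pred valring} := fun x => val x \in vmax.

Lemma maxideal_idealr : idealr_closed maxideal.
Proof.
split; rewrite ?unfold_in /=.
- by rewrite eqxx.
- by rewrite oner_eq0 dval1 ltxx.
move=> [a ha] [x hx] [y hy]; rewrite !unfold_in /=.
move: ha hx hy; rewrite !unfold_in => ha hx hy hxm hym.
have [->|ax0] := eqVneq (a * x) 0; first by rewrite add0r.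
have := ax0; rewrite mulf_eq0 negb_or => /andP[a0 x0].
move: ha hxm; rewrite (negPf a0) (negPf x0) /= => ha hxm.
have hax : 0 < v (a * x) by rewrite dvalM // ltr_wpDl.
have [->|y0] := eqVneq y 0; first by rewrite addr0 hax orbT.
have [//|xy0 /=] := eqVneq (a * x + y) 0.
move: hym; rewrite (negPf y0) /= => hym.
by apply: (lt_le_trans _ (dvalD v ax0 y0 xy0)); rewrite lt_min hax.
Qed.
HB.instance Definition _ := isIdealr.Build valring maxideal maxideal_idealr.

Definition residue_field := {ideal_quot maxideal}.
HB.instance Definition _ := GRing.ComNzRing.on residue_field.

(* The reduction map O_K -> k, extended by 0 outside O_K. *)
Definition vred (x : K) : residue_field :=
  \pi_residue_field (insubd (0 : valring) x).

Lemma vred_val (x : valring) : vred (val x) = \pi_residue_field x.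
Proof. by rewrite /vred valKd. Qed.

Lemma vred_eq0 x : x \in vring -> (vred x == 0) = (x \in vmax).
Proof.
move=> hx; rewrite /vred.
have -> : 0 = \pi_residue_field 0 by apply/esym; exact: pi_zeror.
by rewrite -Quotient.idealrBE subr0 [LHS]unfold_in /= insubdK.
Qed.

Lemma vred1 : vred 1 = 1.
Proof. by rewrite -(rmorph1 (val : valring -> K)) vred_val; exact: rmorph1. Qed.

Lemma vredM : {in vring &, {morph vred : x y / x * y}}.
Proof.
move=> x y hx hy.
rewrite -[x](insubdK (0 : valring) hx) -[y](insubdK (0 : valring) hy).
by rewrite -rmorphM !vred_val rmorphM.
Qed.

Definition residue_inv (x : residue_field) : residue_field :=
  if x == 0 then 0 else vred (val (repr x))^-1.

Lemma residue_mulV (x : residue_field) : x != 0 -> residue_inv x * x = 1.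
Proof.
rewrite /residue_inv => x0; rewrite (negPf x0).
have xE : x = vred (val (repr x)) by rewrite vred_val reprK.
have hx := valP (repr x).
move: x0; rewrite {1}xE vred_eq0 // unfold_in negb_or => /andP[r0 hr].
move: (hx); rewrite unfold_in (negPf r0) /= => hr'.
have v0 : v (val (repr x)) = 0 by apply/eqP; rewrite eq_le hr' leNgt hr.
have hV : (val (repr x))^-1 \in vring.
  by rewrite unfold_in dvalV // v0 oppr0 lexx orbT.
by rewrite {2}xE -vredM // mulVf // vred1.
Qed.

Lemma residue_inv0 : residue_inv 0 = 0.
Proof. by rewrite /residue_inv eqxx. Qed.

HB.instance Definition _ :=
  GRing.ComNzRing_isField.Build residue_field residue_mulV residue_inv0.

Lemma vunit_neq0 x : x \in vunit -> x != 0.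
Proof. by move=> /and3P[]; rewrite unitfE. Qed.

Lemma vred_unit_neq0 x : x \in vunit -> vred x != 0.
Proof.
move=> /and3P[]; rewrite unitfE => x0 hx; rewrite vred_eq0 // !unfold_in.
by rewrite (negPf x0) invr_eq0 (negPf x0) /= dvalV // oppr_ge0 leNgt.
Qed.

End ResidueField.

(* Quat q1 qx qy qz is q1 + qx x + qy y + qz z in the algebra with generators *)
(* x, y and relations x^2 = a, y^2 = b, z = xy = -yx, hence z^2 = -ab,        *)
(* xz = -zx = ay, zy = -yz = bx.                                              *)
Record quat (F : fieldType) (a b : F) :=
  Quat { q1 : F; qx : F; qy : F; qz : F }.

Section Quaternion.
Variables (F : fieldType) (a b : F).
Local Notation Q := (quat a b).
Implicit Types d e : Q.

Definition quat_tuple d := (q1 d, qx d, qy d, qz d).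
Definition tuple_quat (t : F * F * F * F) : Q :=
  Quat a b t.1.1.1 t.1.1.2 t.1.2 t.2.
Lemma quat_tupleK : cancel quat_tuple tuple_quat. Proof. by case. Qed.
HB.instance Definition _ := Choice.copy Q (can_type quat_tupleK).

Lemma quatP d e :
  [/\ q1 d = q1 e, qx d = qx e, qy d = qy e & qz d = qz e] -> d = e.
Proof. by case: d e => [????] [????] /= [-> -> -> ->]. Qed.

Definition quat0 : Q := Quat a b 0 0 0 0.
Definition quat_opp d : Q := Quat a b (- q1 d) (- qx d) (- qy d) (- qz d).
Definition quat_add d e : Q :=
  Quat a b (q1 d + q1 e) (qx d + qx e) (qy d + qy e) (qz d + qz e).
Definition quat1 : Q := Quat a b 1 0 0 0.
Definition quat_mul d e : Q := Quat a b
  (q1 d * q1 e + a * (qx d * qx e) + b * (qy d * qy e) - a * b * (qz d * qz e))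
  (q1 d * qx e + qx d * q1 e + b * (qz d * qy e) - b * (qy d * qz e))
  (q1 d * qy e + qy d * q1 e + a * (qx d * qz e) - a * (qz d * qx e))
  (q1 d * qz e + qz d * q1 e + qx d * qy e - qy d * qx e).
Definition quat_scale (c : F) d : Q :=
  Quat a b (c * q1 d) (c * qx d) (c * qy d) (c * qz d).

Lemma quat_addA : associative quat_add.
Proof. by move=> *; apply: quatP; split; rewrite /= addrA. Qed.
Lemma quat_addC : commutative quat_add.
Proof. by move=> *; apply: quatP; split; rewrite /= addrC. Qed.
Lemma quat_add0 : left_id quat0 quat_add.
Proof. by move=> *; apply: quatP; split; rewrite /= add0r. Qed.
Lemma quat_addN : left_inverse quat0 quat_opp quat_add.
Proof. by move=> *; apply: quatP; split; rewrite /= addNr. Qed.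
HB.instance Definition _ :=
  GRing.isZmodule.Build Q quat_addA quat_addC quat_add0 quat_addN.

Lemma quat_mulA : associative quat_mul.
Proof. by move=> *; apply: quatP; split=> /=; ring. Qed.
Lemma quat_mul1l : left_id quat1 quat_mul.
Proof. by move=> *; apply: quatP; split=> /=; ring. Qed.
Lemma quat_mul1r : right_id quat1 quat_mul.
Proof. by move=> *; apply: quatP; split=> /=; ring. Qed.
Lemma quat_mulDl : left_distributive quat_mul +%R.
Proof. by move=> *; apply: quatP; split=> /=; ring. Qed.
Lemma quat_mulDr : right_distributive quat_mul +%R.
Proof. by move=> *; apply: quatP; split=> /=; ring. Qed.
Lemma quat1_neq0 : quat1 != 0.
Proof. by apply/eqP => /(congr1 (@q1 F a b)) /eqP; rewrite oner_eq0. Qed.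
HB.instance Definition _ := GRing.Zmodule_isNzRing.Build Q
  quat_mulA quat_mul1l quat_mul1r quat_mulDl quat_mulDr quat1_neq0.

Lemma quat_scaleA c1 c2 d : quat_scale c1 (quat_scale c2 d) = quat_scale (c1 * c2) d.
Proof. by apply: quatP; split; rewrite /= mulrA. Qed.
Lemma quat_scale1 : left_id 1 quat_scale.
Proof. by move=> *; apply: quatP; split; rewrite /= mul1r. Qed.
Lemma quat_scaleDr : right_distributive quat_scale +%R.
Proof. by move=> *; apply: quatP; split; rewrite /= mulrDr. Qed.
Lemma quat_scaleDl d : {morph quat_scale^~ d : c1 c2 / c1 + c2}.
Proof. by move=> *; apply: quatP; split; rewrite /= mulrDl. Qed.
HB.instance Definition _ := GRing.Zmodule_isLmodule.Build F Q
  quat_scaleA quat_scale1 quat_scaleDr quat_scaleDl.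

Lemma quat_scaleAl c d e : c *: (d * e) = (c *: d) * e.
Proof. by apply: quatP; split=> /=; ring. Qed.
HB.instance Definition _ := GRing.Lmodule_isLalgebra.Build F Q quat_scaleAl.
Lemma quat_scaleAr c d e : c *: (d * e) = d * (c *: e).
Proof. by apply: quatP; split=> /=; ring. Qed.
HB.instance Definition _ := GRing.Lalgebra_isAlgebra.Build F Q quat_scaleAr.

Definition quat_row d : 'rV[F]_4 :=
  \row_i [:: q1 d; qx d; qy d; qz d]`_i.
Definition row_quat (r : 'rV[F]_4) : Q :=
  Quat a b (r 0 (inord 0)) (r 0 (inord 1)) (r 0 (inord 2)) (r 0 (inord 3)).
Lemma quat_vect : Vector.axiom 4 Q.
Proof.
exists quat_row.
  move=> c d e; apply/rowP=> i; rewrite !mxE.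
  by case: i => [[|[|[|[|?]]]] ?].
exists row_quat => [d|r].
  by apply: quatP; split; rewrite /= mxE inordK.
apply/rowP=> i; rewrite !mxE.
by case: i => [[|[|[|[|?]]]] ?] //=; congr (r 0 _); apply: val_inj; rewrite /= inordK.
Qed.
HB.instance Definition _ := Lmodule_hasFinDim.Build F Q quat_vect.
HB.instance Definition _ := Algebra_isFalgebra.Build F Q.

Definition quatx : Q := Quat a b 0 1 0 0.
Definition quaty : Q := Quat a b 0 0 1 0.
Definition quatz : Q := Quat a b 0 0 0 1.

Definition quat_nrd d : F :=
  q1 d ^+ 2 - a * qx d ^+ 2 - b * qy d ^+ 2 + a * b * qz d ^+ 2.

Definition quat_conj d : Q := Quat a b (q1 d) (- qx d) (- qy d) (- qz d).

End Quaternion.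

Lemma quat_relations (F : fieldType) (a b : F) :
  let x := quatx a b in let y := quaty a b in let z := quatz a b in
  [/\ x ^+ 2 = a%:A, y ^+ 2 = b%:A, x * y = z & y * x = - z].
Proof. by split; apply: quatP; split=> /=; ring. Qed.

Record involution (E : nzRingType) := Involution {
  inv_fun :> E -> E;
  invD : {morph inv_fun : d e / d + e};
  invM : forall d e, inv_fun (d * e) = inv_fun e * inv_fun d;
  invK : involutive inv_fun
}.

Section InvolutionTheory.
Variables (E : nzRingType) (sigma : involution E).

Lemma inv0 : sigma 0 = 0.
Proof. by apply: (addrI (sigma 0)); rewrite -invD !addr0. Qed.
Lemma invN d : sigma (- d) = - sigma d.
Proof. by apply/eqP; rewrite -addr_eq0 -invD addNr inv0. Qed.
Lemma inv1 : sigma 1 = 1.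
Proof. by rewrite -[LHS]mul1r -{1}(invK sigma 1) -invM mul1r invK. Qed.
Lemma inv_sign (s : bool) : sigma ((-1) ^+ s) = (-1) ^+ s.
Proof.
case: s; last by rewrite expr0 inv1.
by rewrite expr1 invN inv1.
Qed.

End InvolutionTheory.

Section Canonical.
Variables (F : fieldType) (a b : F).

Lemma quat_conjD : {morph @quat_conj F a b : d e / d + e}.
Proof. by move=> *; apply: quatP; split; rewrite /= ?opprD. Qed.
Lemma quat_conjM d e : @quat_conj F a b (d * e) = quat_conj e * quat_conj d.
Proof. by apply: quatP; split=> /=; ring. Qed.
Lemma quat_conjK : involutive (@quat_conj F a b).
Proof. by move=> *; apply: quatP; split; rewrite /= ?opprK. Qed.
Definition tau : involution (quat a b) :=
  Involution quat_conjD quat_conjM quat_conjK.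

End Canonical.

Section Twist.
Variables (E : unitRingType) (sigma : involution E) (lambda : E).

Definition twist_fun (d : E) : E := lambda * sigma d * lambda^-1.

(* The condition under which twist_fun is again an involution. *)
Definition twistable : bool :=
  (lambda \is a GRing.unit)
  && ((sigma lambda == lambda) || (sigma lambda == - lambda)).

Hypothesis Hl : twistable.

Lemma twistD : {morph twist_fun : d e / d + e}.
Proof. by move=> d e; rewrite /twist_fun invD mulrDr mulrDl. Qed.
Lemma twistM d e : twist_fun (d * e) = twist_fun e * twist_fun d.
Proof.
case/andP: Hl => Hu _.
by rewrite /twist_fun invM !mulrA mulrVK.
Qed.
Lemma twistK : involutive twist_fun.
Proof.
case/andP: Hl => Hu Hs d; rewrite /twist_fun !invM invK.
have HV : sigma lambda^-1 = (sigma lambda)^-1.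
  have Hsu : sigma lambda \is a GRing.unit.
    by case/orP: Hs => /eqP ->; rewrite ?unitrN.
  by apply: (mulIr Hsu); rewrite mulVr // -invM mulrV // inv1.
rewrite HV; case/orP: Hs => /eqP ->.
  by rewrite !mulrA mulrV // mul1r -mulrA mulrV // mulr1.
by rewrite invrN !(mulrN, mulNr) opprK !mulrA mulrV // mul1r -mulrA mulrV // mulr1.
Qed.
Definition twist : involution E := Involution twistD twistM twistK.

End Twist.

Lemma quatx_twistable (F : fieldType) (a b : F) :
  a != 0 -> twistable (tau a b) (quatx a b).
Proof.
move=> a0; apply/andP; split; last first.
  by apply/orP; right; apply/eqP/quatP; split; rewrite /= ?oppr0.
have h1 : quatx a b * (a^-1 *: quatx a b) = 1.
  by apply: quatP; split=> /=; field.
have h2 : a^-1 *: quatx a b * quatx a b = 1.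
  by apply: quatP; split=> /=; field.
by apply/unitrP; exists (a^-1 *: quatx a b).
Qed.

(* Over a field of characteristic different from 2, an involution of the      *)
(* first kind on a central simple algebra of degree n is orthogonal when its  *)
(* symmetric elements have dimension n(n+1)/2.                                *)
Definition orthogonal_involution (F : fieldType) (A : falgType F)
    (rho : involution A) : Prop :=
  [/\ forall (c : F) e, rho (c *: e) = c *: rho e
    & exists (n : nat) (U : {vspace A}),
      [/\ \dim {:A} = (n ^ 2)%N, forall e, (e \in U) = (rho e == e)
        & \dim U = 'C(n.+1, 2)]].

(* The sign epsilon is (-1) ^+ s, with s : bool; s = true is the              *)
(* skew-hermitian case. A form on the left module E^n of row vectors is given *)
(* by its Gram matrix M, i.e., h(u, w) = u M (w^T)^sigma, so that             *)
(* h(c u, d w) = c h(u, w) sigma(d).                                          *)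
Section Forms.
Variables (E : unitRingType) (sigma : involution E) (s : bool).

Definition Sym : {pred E} := fun e => sigma e == (-1) ^+ s * e.

Definition ctr m n (M : 'M[E]_(m, n)) : 'M[E]_(n, m) := map_mx sigma M^T.

Lemma ctrM m n p (M : 'M[E]_(m, n)) (N : 'M_(n, p)) :
  ctr (M *m N) = ctr N *m ctr M.
Proof.
apply/matrixP=> i j; rewrite !mxE.
rewrite (big_morph sigma (invD sigma) (inv0 sigma)).
by apply: eq_bigr => k _; rewrite !mxE invM.
Qed.

Lemma ctr_block m1 m2 n1 n2 (A : 'M[E]_(m1, n1)) (B : 'M_(m1, n2)) (C : 'M_(m2, n1))
    (D : 'M_(m2, n2)) :
  ctr (block_mx A B C D) = block_mx (ctr A) (ctr C) (ctr B) (ctr D).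
Proof. by rewrite /ctr tr_block_mx map_block_mx. Qed.

Lemma ctr0 m n : ctr (0 : 'M[E]_(m, n)) = 0.
Proof. by apply/matrixP=> i j; rewrite !mxE inv0. Qed.

Lemma ctr1 n : ctr (1%:M : 'M[E]_n) = 1%:M.
Proof.
apply/matrixP=> i j; rewrite !mxE eq_sym.
by case: (i == j); rewrite ?inv1 ?inv0.
Qed.

Definition mx_invertible m n (M : 'M[E]_(m, n)) : Prop :=
  exists N : 'M[E]_(n, m), M *m N = 1%:M /\ N *m M = 1%:M.

Record form := Form {
  form_dim : nat;
  gram : 'M[E]_form_dim;
  gram_sym : ctr gram = (-1) ^+ s *: gram;
  gram_nondeg : mx_invertible gram
}.
HB.instance Definition _ := gen_eqMixin form.
HB.instance Definition _ := gen_choiceMixin form.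

Definition isometric (g h : form) : Prop :=
  exists P : 'M[E]_(form_dim g, form_dim h),
    mx_invertible P /\ P *m gram h *m ctr P = gram g.

Lemma isometric_refl h : isometric h h.
Proof.
exists 1%:M; split; last by rewrite mul1mx ctr1 mulmx1.
by exists 1%:M; rewrite mulmx1.
Qed.

Lemma isometric_sym g h : isometric g h -> isometric h g.
Proof.
move=> [P [[Q [PQ QP]] e]]; exists Q; split; first by exists P.
have e1 : ctr P *m ctr Q = 1%:M by rewrite -ctrM QP ctr1.
by rewrite -e !mulmxA QP mul1mx -mulmxA e1 mulmx1.
Qed.

Lemma isometric_trans g h k : isometric g h -> isometric h k -> isometric g k.
Proof.
move=> [P [[P' [PP' P'P]] eP]] [Q [[Q' [QQ' Q'Q]] eQ]].
exists (P *m Q); split; last by rewrite ctrM -eP -eQ !mulmxA.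
exists (Q' *m P'); split.
  by rewrite mulmxA -(mulmxA P) QQ' mulmx1.
by rewrite mulmxA -(mulmxA Q') P'P mulmx1.
Qed.

Section Orth.
Variables g h : form.
Lemma orth_sym :
  ctr (block_mx (gram g) 0 0 (gram h))
    = (-1) ^+ s *: block_mx (gram g) 0 0 (gram h).
Proof. by rewrite ctr_block !ctr0 !gram_sym scale_block_mx !scaler0. Qed.
Lemma orth_nondeg : mx_invertible (block_mx (gram g) 0 0 (gram h)).
Proof.
case: (gram_nondeg g) => N [e1 e2]; case: (gram_nondeg h) => N' [e3 e4].
exists (block_mx N 0 0 N').
by rewrite !mulmx_block !mul0mx !mulmx0 !addr0 !add0r e1 e2 e3 e4 -!scalar_mx_block.
Qed.
Definition orth : form := Form orth_sym orth_nondeg.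
End Orth.

Lemma form0_sym : ctr (0 : 'M[E]_0) = (-1) ^+ s *: 0.
Proof. by rewrite ctr0 scaler0. Qed.
Lemma form0_nondeg : mx_invertible (0 : 'M[E]_0).
Proof. by exists 0; split; apply/matrixP=> [[]]. Qed.
Definition form0 : form := Form form0_sym form0_nondeg.

Lemma hplane_sym :
  ctr (block_mx 0 1%:M ((-1) ^+ s)%:M 0 : 'M[E]_(1 + 1))
    = (-1) ^+ s *: block_mx 0 1%:M ((-1) ^+ s)%:M 0.
Proof.
rewrite ctr_block !ctr0 ctr1 scale_block_mx !scaler0.
congr block_mx; last by rewrite scale_scalar_mx -signr_addb addbb.
by apply/matrixP=> i j; rewrite !mxE !ord1 /= !mulr1n mulr1 inv_sign.
Qed.
Lemma hplane_nondeg :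
  mx_invertible (block_mx 0 1%:M ((-1) ^+ s)%:M 0 : 'M[E]_(1 + 1)).
Proof.
exists (block_mx 0 ((-1) ^+ s)%:M 1%:M 0).
by rewrite !mulmx_block !mul0mx !mulmx0 !addr0 !add0r !mulmx1 -!scalar_mxM
  -signr_addb addbb -!scalar_mx_block.
Qed.
Definition hplane : form := Form hplane_sym hplane_nondeg.

Definition symunit : {pred E} := fun u => (u \in Sym) && (u \is a GRing.unit).

Section Diag.
Variables (us : seq E) (Hus : all symunit us).
Let M : 'M[E]_(size us) := diag_mx (\row_i us`_i).
Lemma diag_sym : ctr M = (-1) ^+ s *: M.
Proof.
apply/matrixP=> i j; rewrite !mxE eq_sym.
have [->|_] := eqVneq i j; last by rewrite !mulr0n inv0 mulr0.
have /andP[/eqP -> _] := allP Hus _ (mem_nth 0 (ltn_ord j)).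
by rewrite !mulr1n.
Qed.
Lemma diag_nondeg : mx_invertible M.
Proof.
exists (diag_mx (\row_i (us`_i)^-1)).
have Hu (i : 'I_(size us)) : us`_i \is a GRing.unit.
  by have /andP[] := allP Hus _ (mem_nth 0 (ltn_ord i)).
rewrite !mulmx_diag; split; apply/matrixP=> i j; rewrite !mxE.
  by rewrite mulrV.
by rewrite mulVr.
Qed.
Definition diag_form : form := Form diag_sym diag_nondeg.
End Diag.

Lemma orth_isometric g g' h h' :
  isometric g g' -> isometric h h' -> isometric (orth g h) (orth g' h').
Proof.
move=> [P [[P' [e1 e2]] eP]] [Q [[Q' [e3 e4]] eQ]].
exists (block_mx P 0 0 Q); split.
  exists (block_mx P' 0 0 Q').
  by rewrite !mulmx_block !mul0mx !mulmx0 !addr0 !add0r e1 e2 e3 e4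
    -!scalar_mx_block.
by rewrite /= ctr_block !ctr0 !mulmx_block !mul0mx !mulmx0 !addr0 !add0r
  ?mul0mx ?mulmx0 eP eQ.
Qed.

Lemma orthC g h : isometric (orth g h) (orth h g).
Proof.
exists (block_mx 0 1%:M 1%:M 0); split.
  exists (block_mx 0 1%:M 1%:M 0).
  by rewrite !mulmx_block !mul0mx !mulmx0 !addr0 !add0r !mulmx1 -!scalar_mx_block.
by rewrite /= ctr_block !ctr0 !ctr1 !mulmx_block
  !(mul0mx, mulmx0, mulmx1, mul1mx, addr0, add0r).
Qed.

Lemma isometric_cast g h (e : form_dim g = form_dim h) :
  castmx (e, e) (gram g) = gram h -> isometric g h.
Proof.
case: g h e => n M Ms Mn [m N Ns Nn] /= e; case: m / e N Ns Nn => N Ns Nn.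
rewrite castmx_id => /= eMN; exists 1%:M; split.
  by exists 1%:M; rewrite mulmx1.
by rewrite /= ctr1 mul1mx mulmx1 eMN.
Qed.

Lemma orthA g h k : isometric (orth g (orth h k)) (orth (orth g h) k).
Proof.
apply: isometric_sym.
apply: (@isometric_cast (orth (orth g h) k) (orth g (orth h k)) (esym (addnA _ _ _))).
have := @block_mxA _ _ _ _ _ _ _ (gram g) 0 0 0 (gram h) 0 0 0 (gram k).
by rewrite /= !row_mx0 !col_mx0 => ->.
Qed.

Lemma orth0 h : isometric (orth form0 h) h.
Proof.
apply: (@isometric_cast (orth form0 h) h (erefl _)); rewrite castmx_id.
apply/matrixP=> i j /=.
have ei : i = rshift 0 i by apply: val_inj.
have ej : j = rshift 0 j by apply: val_inj.
apply: etrans (block_mxEdr 0 0 0 (gram h) i j).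
by congr (block_mx _ _ _ _ _ _).
Qed.

Definition isometricb (g h : form) : bool := `[< isometric g h >].
Lemma isometricb_equiv : equiv_class_of isometricb.
Proof.
split=> [h|g h|h g k].
- by apply/asboolP; exact: isometric_refl.
- by apply/asboolP/asboolP; exact: isometric_sym.
- by move=> /asboolP e1 /asboolP e2; apply/asboolP; exact: isometric_trans e1 e2.
Qed.
Canonical isometricb_equivRel := EquivRelPack isometricb_equiv.
Canonical isometricb_encModRel := defaultEncModRel isometricb.

Definition isoclass := {eq_quot isometricb}.
HB.instance Definition _ := Choice.on isoclass.

Definition iso_cls (h : form) : isoclass := \pi_isoclass h.

Lemma iso_clsP g h : reflect (isometric g h) (iso_cls g == iso_cls h).
Proof. by rewrite /iso_cls eqmodE; exact: asboolP. Qed.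

Lemma iso_cls_eq g h : isometric g h -> iso_cls g = iso_cls h.
Proof. by move=> /iso_clsP/eqP. Qed.

Lemma iso_cls_ind (P : isoclass -> Prop) :
  (forall h, P (iso_cls h)) -> forall c, P c.
Proof. by move=> H c; rewrite -[c]reprK; exact: H. Qed.

Definition iso_add (c d : isoclass) : isoclass := iso_cls (orth (repr c) (repr d)).

Lemma iso_addE g h : iso_add (iso_cls g) (iso_cls h) = iso_cls (orth g h).
Proof.
apply: iso_cls_eq; apply: orth_isometric; apply/iso_clsP;
  by rewrite /iso_cls reprK.
Qed.

Lemma iso_addA : associative iso_add.
Proof.
elim/iso_cls_ind=> g; elim/iso_cls_ind=> h; elim/iso_cls_ind=> k.
by rewrite !iso_addE; apply: iso_cls_eq; exact: orthA.
Qed.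
Lemma iso_addC : commutative iso_add.
Proof.
elim/iso_cls_ind=> g; elim/iso_cls_ind=> h.
by rewrite !iso_addE; apply: iso_cls_eq; exact: orthC.
Qed.
Lemma iso_add0 : left_id (iso_cls form0) iso_add.
Proof.
by elim/iso_cls_ind=> g; rewrite !iso_addE; apply: iso_cls_eq; exact: orth0.
Qed.
HB.instance Definition _ := GRing.isNmodule.Build isoclass iso_addA iso_addC iso_add0.

Lemma iso_clsD g h : iso_cls (orth g h) = iso_cls g + iso_cls h.
Proof. by apply: esym; apply: iso_addE. Qed.

End Forms.

(* The Grothendieck group of a commutative monoid V modulo the subgroup       *)
(* generated by an element h: pairs (p, q) stand for formal differences.      *)
Section Grothendieck.
Variables (V : nmodType) (h : V).

Definition groth_rel (p q : V * V) : bool :=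
  `[< exists (c : V) (m n : nat),
      p.1 + q.2 + c + h *+ m = q.1 + p.2 + c + h *+ n >].

Lemma groth_equiv : equiv_class_of groth_rel.
Proof.
split=> [p|p q|q p r].
- by apply/asboolP; exists 0, 0%N, 0%N.
- by apply/asboolP/asboolP => -[c [m [n e]]]; exists c, n, m.
move=> /asboolP[c [m [n e1]]] /asboolP[c' [m' [n' e2]]]; apply/asboolP.
exists (q.1 + q.2 + c + c'), (m + m')%N, (n + n')%N.
have := congr2 +%R e1 e2; rewrite !mulrnDr.
rewrite [LHS](AC (4*4) ((1*6)*(5*2*3*7)*(4*8))).
by rewrite [RHS](AC (4*4) ((5*2)*(1*6*3*7)*(4*8))).
Qed.
Canonical groth_equivRel := EquivRelPack groth_equiv.
Canonical groth_encModRel := defaultEncModRel groth_rel.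

Definition groth := {eq_quot groth_rel}.
HB.instance Definition _ := Choice.on groth.

Definition groth_cls (p : V * V) : groth := \pi_groth p.

Lemma groth_clsP p q : reflect (exists (c : V) (m n : nat),
    p.1 + q.2 + c + h *+ m = q.1 + p.2 + c + h *+ n)
  (groth_cls p == groth_cls q).
Proof. by rewrite /groth_cls eqmodE; exact: asboolP. Qed.

Lemma groth_ind (P : groth -> Prop) :
  (forall p, P (groth_cls p)) -> forall x, P x.
Proof. by move=> H x; rewrite -[x]reprK; exact: H. Qed.

Definition groth_add (x y : groth) : groth :=
  groth_cls ((repr x).1 + (repr y).1, (repr x).2 + (repr y).2).
Definition groth_opp (x : groth) : groth := groth_cls ((repr x).2, (repr x).1).

Lemma groth_addE p q :
  groth_add (groth_cls p) (groth_cls q) = groth_cls (p.1 + q.1, p.2 + q.2).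
Proof.
rewrite /groth_add.
have /groth_clsP[c [m [n e1]]] : groth_cls (repr (groth_cls p)) == groth_cls p.
  by rewrite /groth_cls reprK.
have /groth_clsP[c' [m' [n' e2]]] : groth_cls (repr (groth_cls q)) == groth_cls q.
  by rewrite /groth_cls reprK.
apply/eqP/groth_clsP; exists (c + c'), (m + m')%N, (n + n')%N => /=.
have := congr2 +%R e1 e2; rewrite !mulrnDr.
rewrite [LHS](AC (4*4) ((1*5)*(2*6)*(3*7)*(4*8))).
by rewrite [RHS](AC (4*4) ((1*5)*(2*6)*(3*7)*(4*8))).
Qed.

Lemma groth_oppE p : groth_opp (groth_cls p) = groth_cls (p.2, p.1).
Proof.
rewrite /groth_opp.
have /groth_clsP[c [m [n e]]] : groth_cls (repr (groth_cls p)) == groth_cls p.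
  by rewrite /groth_cls reprK.
apply/eqP/groth_clsP; exists c, n, m => /=.
by rewrite [_ + p.1]addrC [p.2 + _]addrC e.
Qed.

Lemma groth_addA : associative groth_add.
Proof.
elim/groth_ind=> p; elim/groth_ind=> q; elim/groth_ind=> r.
by rewrite !groth_addE /= !addrA.
Qed.
Lemma groth_addC : commutative groth_add.
Proof.
elim/groth_ind=> p; elim/groth_ind=> q.
by rewrite !groth_addE /= [p.1 + _]addrC [p.2 + _]addrC.
Qed.
Lemma groth_add0 : left_id (groth_cls (0, 0)) groth_add.
Proof.
by elim/groth_ind=> p; rewrite groth_addE /= !add0r; case: p.
Qed.
Lemma groth_addN : left_inverse (groth_cls (0, 0)) groth_opp groth_add.
Proof.
elim/groth_ind=> p; rewrite groth_oppE groth_addE /=.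
by apply/eqP/groth_clsP; exists 0, 0%N, 0%N; rewrite /= !addr0 add0r addrC.
Qed.
HB.instance Definition _ :=
  GRing.isZmodule.Build groth groth_addA groth_addC groth_add0 groth_addN.

End Grothendieck.

Definition witt (E : unitRingType) (sigma : involution E) (s : bool) :=
  groth (iso_cls (hplane sigma s)).

Definition witt_cls (E : unitRingType) (sigma : involution E) (s : bool)
    (h : form sigma s) : witt sigma s :=
  groth_cls (iso_cls (hplane sigma s)) (iso_cls h, 0).

Definition division_algebra (E : unitRingType) : Prop :=
  forall d : E, d != 0 -> d \is a GRing.unit.

Section QuaternionValuation.
Variables (K : fieldType) (v : dvaluation K) (a b : K).
Local Notation D := (quat a b).

(* As for v, only the values at nonzero arguments are meaningful. *)
Definition nuD (d : D) : rat := (v (quat_nrd d))%:~R / 2%:R.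

Definition OD : {pred D} := fun d => (d == 0) || (0 <= nuD d).
Definition mD : {pred D} := fun d => (d == 0) || (0 < nuD d).
Definition ODunit : {pred D} :=
  fun d => [&& d \is a GRing.unit, d \in OD & d^-1 \in OD].

(* Reduction of coordinates. For units a, b of O_K, this is reduction modulo  *)
(* m_D on O_D, under the identification of O_D / m_D with the quaternion      *)
(* algebra (vred a, vred b) over the residue field.                           *)
Definition qred (d : D) : quat (vred v a) (vred v b) :=
  Quat (vred v a) (vred v b)
    (vred v (q1 d)) (vred v (qx d)) (vred v (qy d)) (vred v (qz d)).

End QuaternionValuation.

Arguments nuD {K} v a b d.
Arguments OD {K} v a b d.
Arguments mD {K} v a b d.
Arguments ODunit {K} v a b d.
Arguments qred {K} v a b d.

(* bar restricts to a surjective ring morphism O -> Eb with kernel m. *)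
Definition is_reduction (E Eb : nzRingType) (O m : {pred E}) (bar : E -> Eb) : Prop :=
  [/\ subring_closed O,
      {in O &, {morph bar : d e / d + e}},
      {in O &, {morph bar : d e / d * e}} /\ bar 1 = 1,
      forall e, exists2 d, d \in O & bar d = e
    & {in O, forall d, (bar d == 0) = (d \in m)}].

Definition tau_x (F : fieldType) (a b : F) (a0 : a != 0) : involution (quat a b) :=
  twist (quatx_twistable b a0).

Definition eps_uniformizer (E : unitRingType) (nu : E -> rat)
    (sigma : involution E) (s : bool) (p : E) : Prop :=
  [/\ p != 0, p \in Sym sigma s, 0 < nu p
    & forall d, d != 0 -> 0 < nu d -> nu p <= nu d].

(* sigma0 and sigma1 are the involutions induced on the residue algebra by    *)
(* sigma and by twist_fun sigma p.                                            *)
Definition is_larmour (E Eb : unitRingType) (nu : E -> rat) (bar : E -> Eb)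
    (sigma : involution E) (s : bool) (p : E) (sigma0 sigma1 : involution Eb)
    (partial : witt sigma s -> witt sigma0 s * witt sigma1 false) : Prop :=
  forall (us vs : seq E)
    (hu : all (symunit sigma s) us) (hv : all (symunit sigma s) vs),
    {in us, forall u, nu u = 0} -> {in vs, forall w, nu w = nu p} ->
  exists (hu' : all (symunit sigma0 s) [seq bar u | u <- us])
         (hv' : all (symunit sigma1 false) [seq bar (w * p^-1) | w <- vs]),
    partial (witt_cls (orth (diag_form hu) (diag_form hv)))
      = (witt_cls (diag_form hu'), witt_cls (diag_form hv')).

(* Main.v *)
From HB Require Import structures.
Require Import Defs.
From mathcomp Require Import all_boot all_order all_algebra all_field.
From mathcomp Require Import boolp ring zify.
Import Defs.

(** Larmour's isomorphism is obtained as the inverse of a homomorphism in the other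
    direction. Let Dbar be the residue algebra of D. A skew-hermitian form over Dbar
    can be diagonalized, and its entries lift to skew units of O_D; this gives a form
    over D.
    The lift is unique up to isometry by Hensel's lemma. In dimension one (skew_lift)
    this rests on square roots of 1-units in K (one_unit_sqrt) and on an explicit
    conjugation of pure quaternions of equal norm (quat_pure_conj); in higher
    dimension Gaussian elimination over O_D reduces to lines (skew_mx_lift,
    skew_diag_lift). So lifting is a homomorphism of Witt groups (witt_lift). On the second factor, a hermitian form for tau_x is first multiplied
    by x, which makes it skew-hermitian for tau, and its lift is then multiplied by
    pi. As pi x is the chosen uniformizer, the sum of the two homomorphisms is inverse
    to the residue maps on diagonal forms (larmour_inverse).

    The sum is surjective because each line is isometric to one of valuation 0 or 1
    (line_unit_or_uniformizer). For injectivity, represent both components by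
    anisotropic forms. The nonzero values of their lifts have even and odd
    valuation respectively, so the orthogonal sum over D is anisotropic (anisotropic_lift), and
    an anisotropic form of class 0 has dimension 0 (witt_anisotropic_eq0). The latter
    is Witt cancellation, proved for matrices over any division algebra with
    involution in which 2 is invertible by a feedback construction (mx_feedback).

    That Dbar is a division algebra and that nu_D is the least valuation of a
    coordinate both follow from the residual norm form being anisotropic, which is
    again Hensel's lemma for squares (residue_nrd_q1). *)

Set Implicit Arguments.
Unset Strict Implicit.
Unset Printing Implicit Defensive.
Import Order.TTheory GRing.Theory Num.Theory.
Local Open Scope ring_scope.

(** * Congruence of matrices over a ring with involution *)

Section Congruence.
Variables (E : unitRingType) (sigma : involution E).
Local Notation ctr := (ctr sigma).

Lemma mx_invertible1 n : mx_invertible (1%:M : 'M[E]_n).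
Proof. by exists 1%:M; rewrite mulmx1. Qed.

Lemma mx_invertibleM m n p (M : 'M[E]_(m, n)) (N : 'M_(n, p)) :
  mx_invertible M -> mx_invertible N -> mx_invertible (M *m N).
Proof.
move=> [M' [e1 e2]] [N' [e3 e4]]; exists (N' *m M').
by rewrite mulmxA -(mulmxA M) e3 mulmx1 e1 mulmxA -(mulmxA N') e2 mulmx1 e4.
Qed.

Lemma mx_invertible_block m n m' n' (A : 'M[E]_(m, m')) (B : 'M[E]_(n, n')) :
  mx_invertible A -> mx_invertible B -> mx_invertible (block_mx A 0 0 B).
Proof.
move=> [A' [e1 e2]] [B' [e3 e4]]; exists (block_mx A' 0 0 B').
by rewrite !mulmx_block !mul0mx !mulmx0 !addr0 !add0r e1 e2 e3 e4
  -!scalar_mx_block.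
Qed.

Lemma mx_invertible_lower m n (C : 'M[E]_(n, m)) :
  mx_invertible (block_mx 1%:M 0 C 1%:M).
Proof.
exists (block_mx 1%:M 0 (- C) 1%:M).
by rewrite !mulmx_block !mul0mx !mulmx0 !mulmx1 !mul1mx !addr0 !add0r subrr
  addNr -!scalar_mx_block.
Qed.

Lemma mx_invertible_scalar n (c : E) :
  c \is a GRing.unit -> mx_invertible (c%:M : 'M_n).
Proof. by move=> cu; exists c^-1%:M; rewrite -!scalar_mxM mulrV // mulVr. Qed.

Lemma ctrK m n (M : 'M[E]_(m, n)) : ctr (ctr M) = M.
Proof. by apply/matrixP=> i j; rewrite !mxE invK. Qed.

Lemma ctrD m n (M N : 'M[E]_(m, n)) : ctr (M + N) = ctr M + ctr N.
Proof. by apply/matrixP=> i j; rewrite !mxE invD. Qed.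

Lemma ctrN m n (M : 'M[E]_(m, n)) : ctr (- M) = - ctr M.
Proof. by apply/matrixP=> i j; rewrite !mxE invN. Qed.

Lemma ctr_scalar n (c : E) : ctr (c%:M : 'M_n) = (sigma c)%:M.
Proof.
apply/matrixP=> i j; rewrite !mxE eq_sym.
by case: (i == j); rewrite ?mulr1n ?mulr0n ?inv0.
Qed.

Lemma ctr_row m n p (A : 'M[E]_(m, n)) (B : 'M_(m, p)) :
  ctr (row_mx A B) = col_mx (ctr A) (ctr B).
Proof. by rewrite /Defs.ctr tr_row_mx map_col_mx. Qed.

Lemma mx_invertible_ctr m n (M : 'M[E]_(m, n)) :
  mx_invertible M -> mx_invertible (ctr M).
Proof. by move=> [N [e1 e2]]; exists (ctr N); rewrite -!ctrM e1 e2 !ctr1. Qed.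

Lemma sign_mulmx (s : bool) m n p (M : 'M[E]_(m, n)) (N : 'M_(n, p)) :
  M *m ((-1) ^+ s *: N) = (-1) ^+ s *: (M *m N).
Proof. by case: s; rewrite /= ?expr0 ?scale1r // expr1 !scaleN1r mulmxN. Qed.

Lemma sign_mxK (s : bool) m n (M : 'M[E]_(m, n)) :
  (-1) ^+ s *: ((-1) ^+ s *: M) = M.
Proof. by rewrite scalerA -signr_addb addbb scale1r. Qed.

(** Isometry of Gram matrices, without the proofs that make them forms: by
    definition, isometric g h is mxcong (gram g) (gram h). *)
Definition mxcong m n (M : 'M[E]_m) (N : 'M[E]_n) : Prop :=
  exists P : 'M_(m, n), mx_invertible P /\ P *m N *m ctr P = M.

Lemma mxcong_trans m n p (M : 'M[E]_m) (N : 'M[E]_n) (L : 'M[E]_p) :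
  mxcong M N -> mxcong N L -> mxcong M L.
Proof.
move=> [P [Pi <-]] [Q [Qi <-]]; exists (P *m Q).
by split; [exact: mx_invertibleM | rewrite ctrM !mulmxA].
Qed.

Lemma mxcong_sym m n (M : 'M[E]_m) (N : 'M[E]_n) : mxcong M N -> mxcong N M.
Proof.
move=> [P [[Q [PQ QP]] <-]]; exists Q; split; first by exists P.
by rewrite !mulmxA QP mul1mx -mulmxA -ctrM QP ctr1 mulmx1.
Qed.

Lemma mxcong_block m n p q (M : 'M[E]_m) (N : 'M[E]_n) (M' : 'M[E]_p)
    (N' : 'M[E]_q) :
  mxcong M N -> mxcong M' N' -> mxcong (block_mx M 0 0 M') (block_mx N 0 0 N').
Proof.
move=> [P [Pi <-]] [Q [Qi <-]]; exists (block_mx P 0 0 Q); split.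
  exact: mx_invertible_block.
by rewrite ctr_block !ctr0 !mulmx_block !(mul0mx, mulmx0, addr0, add0r).
Qed.

(** Gaussian elimination for forms: an invertible corner A splits off, and the
    complement is the Schur complement. The involution turns the row operation
    that clears C into the column operation that clears B. *)
Lemma mxcong_schur (s : bool) m n (A A' : 'M[E]_m) (B : 'M_(m, n)) (C : 'M_(n, m))
    (D : 'M_n) :
  A *m A' = 1%:M -> A' *m A = 1%:M ->
  ctr (block_mx A B C D) = (-1) ^+ s *: block_mx A B C D ->
  mxcong (block_mx A 0 0 (D - C *m A' *m B)) (block_mx A B C D).
Proof.
move=> e1 e2; rewrite ctr_block scale_block_mx => /eq_block_mx[sA sC _ _].
have sA' : ctr A' = (-1) ^+ s *: A'.
  rewrite -[LHS]mul1mx -e2 -[A in A' *m A](sign_mxK s) -sA sign_mulmx.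
  by rewrite -scalemxAl -mulmxA -ctrM e2 ctr1 mulmx1.
exists (block_mx 1%:M 0 (- (C *m A')) 1%:M).
split; first exact: mx_invertible_lower.
rewrite ctr_block !ctr0 !ctr1 ctrN ctrM sA' sC -scalemxAl.
rewrite !mulmx_block !(mul0mx, mul1mx, mulmx0, mulmx1, mulNmx, addr0, add0r).
rewrite -(mulmxA C A' A) e2 mulmx1 addNr mul0mx !add0r.
rewrite sign_mulmx sign_mxK mulmxN mulmxA e1 mul1mx addNr.
by rewrite addrC.
Qed.

End Congruence.

(** * Diagonalization of hermitian forms *)

Section Forms.
Variables (E : unitRingType) (sigma : involution E) (s : bool).
Local Notation ctr := (ctr sigma).
Local Notation symu := (symunit sigma s).
Local Notation dmx us := (diag_mx (\row_i us`_i) : 'M[E]_(size us)).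
Local Notation diag hu := (@diag_form E sigma s _ hu).

Lemma diag_mx_cons (u : E) (us : seq E) :
  dmx (u :: us) = block_mx (u%:M : 'M_1) 0 0 (dmx us) :> 'M_(1 + size us).
Proof.
apply/matrixP=> i j; case: (split_ordP i) => i' ->; case: (split_ordP j) => j' ->.
- by rewrite block_mxEul !mxE /= !ord1.
- by rewrite block_mxEur !mxE -val_eqE /= ord1 mulr0n.
- by rewrite block_mxEdl !mxE -val_eqE /= ord1 mulr0n.
- by rewrite block_mxEdr !mxE -val_eqE.
Qed.

Lemma diag_mx1 (u : E) : dmx [:: u] = u%:M.
Proof. by apply/matrixP=> i j; rewrite !mxE !ord1. Qed.

Lemma diag_cons u us (hu : all symu (u :: us)) (h1 : all symu [:: u])
    (h2 : all symu us) :
  iso_cls (diag hu) = iso_cls (diag h1) + iso_cls (diag h2).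
Proof.
rewrite -iso_clsD; apply: iso_cls_eq; exists 1%:M; split.
  exact: mx_invertible1.
rewrite ctr1 mul1mx mulmx1 /=.
by rewrite [RHS]diag_mx_cons diag_mx1.
Qed.

Lemma diag_nil (h : all symu [::]) : iso_cls (diag h) = 0.
Proof.
apply: iso_cls_eq; exists 1%:M; split; first exact: mx_invertible1.
by apply/matrixP=> -[].
Qed.

Lemma diag_cat us vs (h : all symu (us ++ vs)) (hu : all symu us)
    (hv : all symu vs) :
  iso_cls (diag h) = iso_cls (diag hu) + iso_cls (diag hv).
Proof.
elim: us h hu => [|u us IH] h hu.
  by rewrite diag_nil add0r; congr (iso_cls (diag _)); apply: bool_irrelevance.
have [h1 h2] : all symu [:: u] /\ all symu us by move: hu => /= /andP[-> ->].
have h3 : all symu (us ++ vs) by move: h => /= /andP[].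
by rewrite (diag_cons h h1 h3) (diag_cons hu h1 h2) (IH h3 h2) addrA.
Qed.

Lemma mxcong_sign m n (M : 'M[E]_m) (N : 'M[E]_n) :
  mxcong sigma M N -> ctr N = (-1) ^+ s *: N -> ctr M = (-1) ^+ s *: M.
Proof.
move=> [P [_ <-]] sN; rewrite !ctrM ctrK sN -scalemxAl sign_mulmx.
by rewrite mulmxA.
Qed.

Lemma mxcong_invertible m n (M : 'M[E]_m) (N : 'M[E]_n) :
  mxcong sigma M N -> mx_invertible N -> mx_invertible M.
Proof.
move=> [P [Pi <-]] Ni; apply: mx_invertibleM; last exact: mx_invertible_ctr.
exact: mx_invertibleM.
Qed.

Lemma mx_invertible_corner m n p q (A : 'M[E]_(m, n)) (S : 'M[E]_(p, q)) :
  mx_invertible (block_mx A 0 0 S) -> mx_invertible S.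
Proof.
move=> [N [e1 e2]]; exists (drsubmx N).
move: e1 e2; rewrite -[N]submxK !mulmx_block !(mul0mx, mulmx0, add0r, addr0).
rewrite !scalar_mx_block block_mxKdr.
by move=> /eq_block_mx[_ _ _ ->] /eq_block_mx[_ _ _ ->].
Qed.

Hypothesis Ediv : division_algebra E.

(** A shear of the coordinates gives a nonzero vector a nonzero first coordinate,
    and then it is the first row of an invertible triangular matrix. *)
Lemma row_leading_neq0 n (p : 'rV[E]_(1 + n)) : p != 0 ->
  exists q : 'cV_n, lsubmx p + rsubmx p *m q != 0.
Proof.
move=> p0; have [l0|l0] := eqVneq (lsubmx p) 0; last first.
  by exists 0; rewrite mulmx0 addr0.
have r0 : rsubmx p != 0.
  by apply: contra p0 => /eqP r0; rewrite -[p]hsubmxK l0 r0 row_mx0.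
have [j pj] : exists j, rsubmx p 0 j != 0.
  apply/existsP; apply: contraNT r0; rewrite negb_exists => /forallP pn.
  by apply/eqP/rowP=> j; have := pn j; rewrite negbK => /eqP ->; rewrite mxE.
exists (\col_i (if i == j then (rsubmx p 0 j)^-1 else 0)).
apply/eqP => /matrixP/(_ 0 0); rewrite l0 add0r mxE (bigD1 j) //=.
rewrite big1 => [|i ij]; last by rewrite [X in _ * X]mxE (negPf ij) mulr0.
rewrite [X in _ * X]mxE eqxx addr0 mulrV; last exact: Ediv.
rewrite !mxE.
by apply/eqP; rewrite oner_neq0.
Qed.

Lemma row_complete n (p : 'rV[E]_(1 + n)) : p != 0 ->
  exists2 B : 'M_(1 + n), mx_invertible B & usubmx B = p.
Proof.
move=> /row_leading_neq0[q]; set c := _ + _ => c0.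
have [d [cd dc]] : mx_invertible c.
  have -> : c = (c 0 0)%:M by apply/matrixP=> i j; rewrite !ord1 !mxE mulr1n.
  apply: mx_invertible_scalar; apply: Ediv; apply: contra c0 => /eqP c0.
  by apply/eqP/matrixP=> i j; rewrite !ord1 c0 mxE.
exists (block_mx c (rsubmx p) 0 1%:M *m block_mx 1%:M 0 (- q) 1%:M).
  apply: mx_invertibleM; last exact: mx_invertible_lower.
  exists (block_mx d (- (d *m rsubmx p)) 0 1%:M).
  rewrite !mulmx_block !(mul0mx, mulmx0, mulmx1, add0r, addr0) cd dc.
  by rewrite mulmxN mulmxA cd mul1mx addNr addrN -!scalar_mx_block.
rewrite mulmx_block block_mxEv col_mxKu !(mul0mx, mulmx0, mulmx1, add0r, addr0).
by rewrite mulmxN addrK hsubmxK.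
Qed.

(** A represented unit u splits off as a line: make the vector p that represents
    it the first basis vector and eliminate. *)
Lemma represented_split (g : form sigma s) (p : 'rV_(form_dim g)) u
    (hu : all symu [:: u]) :
  p *m gram g *m ctr p = u%:M ->
  exists2 g', (form_dim g' < form_dim g)%N &
    iso_cls g = iso_cls (diag hu) + iso_cls g'.
Proof.
have uu : u \is a GRing.unit by case/andP: hu => /andP[].
case: g p => -[|n] M Ms Mi /= p ep.
  have /matrixP/(_ 0 0) := ep; rewrite [p]thinmx0 !mul0mx !mxE /= => /esym u0.
  by have := uu; rewrite mulr1n in u0; rewrite {1}u0 unitr0.
have p0 : p != 0.
  apply/eqP=> p0; have /matrixP/(_ 0 0) := ep.
  rewrite p0 !mul0mx !mxE mulr1n => u0.
  by have := uu; rewrite -{1}u0 unitr0.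
have [B Bi Bp] := @row_complete n p p0.
pose N : 'M[E]_(1 + n) := B *m M *m ctr B.
have NM : mxcong sigma N M by exists B.
have Nu : ulsubmx N = u%:M.
  rewrite /N /ulsubmx -!mul_usub_mx Bp.
  rewrite -mulmx_lsub -[RHS]ep; congr (_ *m _).
  by rewrite -Bp; apply/matrixP=> i j; rewrite !mxE.
have u1 : u%:M *m u^-1%:M = 1%:M :> 'M_1 by rewrite -scalar_mxM mulrV.
have u2 : u^-1%:M *m u%:M = 1%:M :> 'M_1 by rewrite -scalar_mxM mulVr.
have Ns := mxcong_sign NM Ms.
move: (NM) (Ns); rewrite -[N]submxK Nu => NM' Ns'.
have := mxcong_trans (mxcong_schur u1 u2 Ns') NM'.
set S := _ - _ => SM.
have Si : mx_invertible S.
  exact: mx_invertible_corner (mxcong_invertible SM Mi).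
have /eq_block_mx[_ _ _ Ss] : block_mx (ctr (u%:M : 'M_1)) 0 0 (ctr S)
    = block_mx ((-1) ^+ s *: u%:M) 0 0 ((-1) ^+ s *: S).
  have := mxcong_sign SM Ms.
  by rewrite ctr_block !ctr0 scale_block_mx !scaler0.
exists (Form Ss Si) => //=.
rewrite -iso_clsD; apply: iso_cls_eq; apply: mxcong_sym.
by rewrite /= diag_mx1.
Qed.

Variable u0 : E.
Hypothesis u0S : symu u0.
Hypothesis two_unit : (2%:R : E) \is a GRing.unit.

(** If r and w satisfy h(r, w) = 1 and are both isotropic, then u0 r + w takes the
    value u0 + eps sigma(u0) = 2 u0, which is nonzero. So a nondegenerate form is
    not alternating once there is an eps-symmetric unit u0. *)
Lemma nonalternating (g : form sigma s) : (0 < form_dim g)%N ->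
  exists p : 'rV_(form_dim g), p *m gram g *m ctr p != 0.
Proof.
case: g => -[|n] M Ms [N [_ NM]] //= _.
pose w : 'rV[E]_n.+1 := row 0 1%:M; pose r := row 0 N.
have rw : r *m M *m ctr w = 1%:M.
  rewrite -row_mul NM; apply/matrixP=> i j; rewrite !ord1 !mxE (bigD1 0) //=.
  by rewrite big1 => [|k k0]; rewrite !mxE ?eqxx ?inv1 ?mulr1 ?addr0 //
    eq_sym (negPf k0) mul0r.
have wr : w *m M *m ctr r = (-1) ^+ s *: 1%:M.
  rewrite -(@ctr1 _ sigma) -rw !ctrM ctrK Ms -scalemxAl sign_mulmx sign_mxK.
  by rewrite mulmxA.
have [wn|] := eqVneq (w *m M *m ctr w) 0; last by exists w.
have [rn|] := eqVneq (r *m M *m ctr r) 0; last by exists r.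
exists (u0%:M *m r + w); rewrite ctrD ctrM ctr_scalar.
rewrite !mulmxDl !mulmxDr !mulmxA -!(mulmxA u0%:M) rn rw wr wn.
rewrite !(mul0mx, mulmx0).
rewrite add0r addr0 mulmx1 -scalemxAl mul1mx.
case/andP: (u0S) => /eqP -> uu.
apply/eqP=> /matrixP/(_ 0 0); rewrite !mxE !mulr1n mulrA -signr_addb addbb mul1r.
rewrite -mulr2n -mulr_natl => e.
have : 2%:R * u0 \is a GRing.unit by rewrite unitrMl.
by rewrite e unitr0.
Qed.

Lemma represented_sym (g : form sigma s) (p : 'rV_(form_dim g)) :
  exists2 u, sigma u = (-1) ^+ s * u & p *m gram g *m ctr p = u%:M.
Proof.
have e : p *m gram g *m ctr p = ((p *m gram g *m ctr p) 0 0)%:M.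
  by apply/matrixP=> i j; rewrite !ord1 [RHS]mxE mulr1n.
exists ((p *m gram g *m ctr p) 0 0) => //.
have /matrixP/(_ 0 0) :
    ctr (p *m gram g *m ctr p) = (-1) ^+ s *: (p *m gram g *m ctr p).
  by rewrite !ctrM ctrK gram_sym -scalemxAl sign_mulmx mulmxA.
by rewrite [in X in X -> _]mxE [in X in X -> _]mxE => ->; rewrite mxE.
Qed.

Lemma diagonalize (g : form sigma s) :
  exists us (hu : all symu us), iso_cls g = iso_cls (diag hu).
Proof.
have [n] := ubnP (form_dim g); elim: n g => // n IH g gn.
have [g0|g0] := posnP (form_dim g).
  exists [::], isT; rewrite diag_nil; apply: iso_cls_eq.
  case: g g0 {gn} => m M Ms Mi /= m0; subst m.
  exists 1%:M; split; first exact: mx_invertible1.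
  by apply/matrixP=> -[].
have [p p0] := nonalternating g0; have [u us up] := represented_sym p.
have hu : all symu [:: u].
  rewrite /= andbT; apply/andP; split; first by apply/eqP.
  apply: Ediv; apply: contra p0 => /eqP v0; rewrite up v0.
  by apply/eqP/matrixP=> i j; rewrite !mxE mul0rn.
have [g' lt_g' ->] := represented_split hu up.
have [|vs [hv ->]] := IH g'; first by apply: leq_trans lt_g' _.
have hw : all symu (u :: vs) by move: hu => /= /andP[-> _].
by exists (u :: vs), hw; rewrite (diag_cons hw hu hv).
Qed.

End Forms.

(** * Witt cancellation *)

Section Witt.
Variables (E : unitRingType) (sigma : involution E) (s : bool).
Local Notation ctr := (ctr sigma).
Local Notation symu := (symunit sigma s).
Local Notation diag hu := (@diag_form E sigma s _ hu).
Local Notation hplane := (hplane sigma s).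
Local Notation witt_cls h := (@witt_cls E sigma s h).

Definition anisotropic (g : form sigma s) : Prop :=
  forall p : 'rV_(form_dim g), p *m gram g *m ctr p = 0 -> p = 0.

Lemma witt_cls_eq g h : iso_cls g = iso_cls h -> witt_cls g = witt_cls h.
Proof. by rewrite /Defs.witt_cls => ->. Qed.

Lemma witt_clsD g h k :
  iso_cls g = iso_cls h + iso_cls k -> witt_cls g = witt_cls h + witt_cls k.
Proof.
by rewrite /Defs.witt_cls => ->; rewrite [RHS]groth_addE /= addr0.
Qed.

Lemma witt_cls0 g : iso_cls g = 0 -> witt_cls g = 0.
Proof. by rewrite /Defs.witt_cls => ->. Qed.

Lemma witt_hplane : witt_cls hplane = 0.
Proof.
by apply/eqP/groth_clsP; exists 0, 0%N, 1%N; rewrite /= !addr0 !add0r.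
Qed.

Lemma witt_clsB g h :
  groth_cls (iso_cls hplane) (iso_cls g, iso_cls h) = witt_cls g - witt_cls h.
Proof.
rewrite [- _]groth_oppE [RHS]groth_addE /= add0r addr0 //.
Qed.

Lemma inv_unit d : d \is a GRing.unit -> sigma d \is a GRing.unit.
Proof.
move=> /unitrP[e [ed de]]; apply/unitrP; exists (sigma e).
by rewrite -!invM ed de inv1.
Qed.

Lemma symunitN u : symu u -> symu (- u).
Proof.
move=> /andP[/eqP su uu]; apply/andP; split; last by rewrite unitrN.
by apply/eqP; rewrite invN su mulrN.
Qed.

Hypothesis Ediv : division_algebra E.
Hypothesis two_unit : (2%:R : E) \is a GRing.unit.

(** In the plane with basis e, f and h(e, e) = u = - h(f, f), the vectors e + f and
    c (e - f) are isotropic, and their product is 1 when sigma(c) = (2 u)^-1. *)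
Lemma hplane_split u (hu : all symu [:: u]) (hN : all symu [:: - u]) :
  iso_cls (diag hu) + iso_cls (diag hN) = iso_cls hplane.
Proof.
have [us uu] : sigma u = (-1) ^+ s * u /\ u \is a GRing.unit.
  by case/andP: hu => /andP[/eqP].
have uu2 : 2%:R * u \is a GRing.unit by rewrite unitrMl.
pose d : E := (2%:R * u)^-1; pose c := sigma d.
have ud : u * d + u * d = 1 by rewrite -mulr2n -mulrnAl -mulr_natl mulrV.
have e1 : c * ((-1) ^+ s * u) + c * ((-1) ^+ s * u) = 1.
  by rewrite -us /c -!invM -invD ud inv1.
have cu : c * u + c * u = (-1) ^+ s.
  rewrite -[RHS]mulr1 -[X in _ = _ * X]e1 mulrDr.
  by case: (s); rewrite /= ?expr0 ?mul1r // expr1 !mulN1r !mulrN !opprK.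
have cU : c \is a GRing.unit by apply: inv_unit; rewrite unitrV.
rewrite -iso_clsD; apply/esym/iso_cls_eq.
exists (block_mx 1%:M 1%:M c%:M (- c)%:M); split.
  pose h : E := 2%:R^-1; have hh : h + h = 1.
    by rewrite -mulr2n -mulr_natl mulrV.
  have ch : c * h = h * c := commrV (commr_nat c 2).
  exists (block_mx h%:M (h * c^-1)%:M h%:M (- (h * c^-1))%:M).
  rewrite !mulmx_block -!scalar_mxM -!raddfD /=.
  rewrite !mul1r !mulr1 !(mulNr, mulrN) opprK mulrA ch -!mulrA mulrV // mulVr //.
  by rewrite !mulr1 hh !subrr opprK hh raddf0 -!scalar_mx_block.
rewrite /= !diag_mx1 ctr_block !ctr_scalar !mulmx_block !(mul0mx, mulmx0, addr0, add0r).
rewrite -!scalar_mxM -!raddfD /= !inv1 !mulr1 !mul1r subrr raddf0 invN.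
by rewrite !(mulNr, mulrN) !opprK cu invK ud subrr raddf0.
Qed.

(** Feeding part of the output of an isometry back into its input leaves an
    isometry. Let P map (x, y) to (x', y'). Given y, let x = y Y be the vector with
    x' = - x; it exists as A + 1 is invertible, and then y' = y Q. Since x and - x
    have the same value under u, cancelling it shows that y and y' have the same
    values under M and N. *)
Lemma mx_feedback m n (u : E) (M : 'M[E]_m) (N : 'M[E]_n) (W : 'M_1)
    (A : 'M_1) (B : 'M_(1, n)) (C : 'M_(m, 1)) (D : 'M_(m, n)) :
  let P := block_mx A B C D in
  (A + 1%:M) *m W = 1%:M -> W *m (A + 1%:M) = 1%:M ->
  P *m block_mx u%:M 0 0 N *m ctr P = block_mx u%:M 0 0 M ->
  let Q := D - C *m W *m B in Q *m N *m ctr Q = M.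
Proof.
move=> P _ WA eP Q; pose Y := - (C *m W).
have YP : row_mx Y 1%:M *m P = row_mx (- Y) Q.
  rewrite mul_row_block !mul1mx /Q /Y !mulNmx opprK [D - _]addrC.
  congr (row_mx _ _); rewrite -[in X in _ + X](mulmx1 C) -WA.
  by rewrite mulmxDr mulmx1 mulmxDr !mulmxA addKr.
clearbody Y.
have : row_mx Y 1%:M *m (P *m block_mx u%:M 0 0 N *m ctr P) *m ctr (row_mx Y 1%:M)
    = row_mx (- Y) Q *m block_mx u%:M 0 0 N *m ctr (row_mx (- Y) Q).
  by rewrite -YP ctrM !mulmxA.
rewrite eP !ctr_row ctr1 !mul_row_block !(mulmx0, addr0, add0r) !mul_row_col.
rewrite mul1mx mulmx1 ctrN !mulNmx mulmxN opprK.
by move=> /addrI.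
Qed.

(** The map Q of mx_feedback is an isometry: its equation gives a right inverse,
    and the equation for the adjoint of P, with all forms inverted, a left one. *)
Lemma mxcong_cancel_feedback m n (u : E) (M : 'M[E]_m) (N : 'M[E]_n)
    (A : 'M_1) (B : 'M_(1, n)) (C : 'M_(m, 1)) (D : 'M_(m, n)) :
  let P := block_mx A B C D in
  u \is a GRing.unit -> mx_invertible M -> mx_invertible N ->
  mx_invertible P -> mx_invertible (A + 1%:M) ->
  P *m block_mx u%:M 0 0 N *m ctr P = block_mx u%:M 0 0 M ->
  mxcong sigma M N.
Proof.
move=> P uu [M' [MM' M'M]] [N' [NN' N'N]] [P' [PP' P'P]] [W [AW WA]] eP.
have eQ := mx_feedback AW WA eP; set Q := D - _ in eQ.
exists Q; split=> //.
have eP' : ctr P *m block_mx u^-1%:M 0 0 M' *m ctr (ctr P)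
    = block_mx u^-1%:M 0 0 N'.
  have uM : block_mx (u%:M : 'M_1) 0 0 M *m block_mx u^-1%:M 0 0 M' = 1%:M.
    rewrite mulmx_block !(mul0mx, mulmx0, addr0, add0r) MM' -scalar_mxM mulrV //.
    by rewrite -scalar_mx_block.
  have uN : block_mx (u^-1%:M : 'M_1) 0 0 N' *m block_mx u%:M 0 0 N = 1%:M.
    rewrite mulmx_block !(mul0mx, mulmx0, addr0, add0r) N'N -scalar_mxM mulVr //.
    by rewrite -scalar_mx_block.
  have e0 : block_mx u%:M 0 0 N *m ctr P = P' *m block_mx u%:M 0 0 M.
    by rewrite -eP !mulmxA P'P mul1mx.
  rewrite ctrK -[LHS]mul1mx -uN -mulmxA -[RHS]mulmx1; congr (_ *m _).
  by rewrite !mulmxA e0 -(mulmxA P') uM mulmx1 P'P.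
have e1 : (ctr A + 1%:M) *m ctr W = 1%:M.
  by rewrite -(@ctr1 _ sigma 1) -ctrD -ctrM WA.
have e2 : ctr W *m (ctr A + 1%:M) = 1%:M.
  by rewrite -(@ctr1 _ sigma 1) -ctrD -ctrM AW.
move: eP'; rewrite [ctr P]ctr_block => /(mx_feedback e1 e2).
have -> : ctr D - ctr B *m ctr W *m ctr C = ctr Q.
  by rewrite /Q ctrD ctrN !ctrM mulmxA.
rewrite /= ctrK => eQ'; exists (N *m ctr Q *m M'); split.
  by rewrite !mulmxA eQ MM'.
by rewrite -!mulmxA (mulmxA (ctr Q)) eQ' NN'.
Qed.

(** Witt cancellation of a line. Of A + 1 and - A + 1, where A is the entry of the
    isometry on that line, one is nonzero as 2 is invertible; so the feedback
    applies to the isometry or to its opposite. *)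
Lemma iso_cls_cancel_line u (hu : all symu [:: u]) g g' :
  iso_cls (diag hu) + iso_cls g = iso_cls (diag hu) + iso_cls g' ->
  iso_cls g = iso_cls g'.
Proof.
have uu : u \is a GRing.unit by case/andP: hu => /andP[].
rewrite -!iso_clsD => /eqP/iso_clsP[]; rewrite /= diag_mx1.
rewrite -[1%N]/(size [:: u]) => P [Pi eP].
apply: iso_cls_eq.
have key (P0 : 'M[E]_(1 + form_dim g, 1 + form_dim g')) :
    mx_invertible P0 ->
    P0 *m block_mx u%:M 0 0 (gram g') *m ctr P0 = block_mx u%:M 0 0 (gram g) ->
    mx_invertible (ulsubmx P0 + 1%:M) -> isometric g g'.
  rewrite -[P0]submxK block_mxKul => P0i eP0 ui.
  exact: (mxcong_cancel_feedback uu (gram_nondeg g) (gram_nondeg g') P0i ui eP0).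
have inv1 (X : 'M[E]_1) : X 0 0 != 0 -> mx_invertible X.
  move=> X0; have -> : X = (X 0 0)%:M.
    by apply/matrixP=> i j; rewrite !ord1 !mxE mulr1n.
  by apply: mx_invertible_scalar; exact: Ediv.
have [e|ne] := eqVneq ((ulsubmx (P : 'M_(1 + _, 1 + _)) + 1%:M) 0 0) 0; last first.
  exact: key Pi eP (inv1 _ ne).
apply: (key (- P)).
- case: Pi => P' [e1 e2]; exists (- P').
  by rewrite !mulNmx !mulmxN !opprK.
- by rewrite ctrN !mulNmx mulmxN opprK.
apply: inv1; move: e; rewrite !mxE /= => /eqP; rewrite addr_eq0 => /eqP ->.
rewrite opprK mulr1n -mulr2n; apply: contraTneq two_unit => ->.
by rewrite unitr0.
Qed.

End Witt.

(** * Anisotropic representatives in the Witt group *)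

Section WittGroup.
Variables (E : unitRingType) (sigma : involution E) (s : bool).
Local Notation ctr := (ctr sigma).
Local Notation symu := (symunit sigma s).
Local Notation diag hu := (@diag_form E sigma s _ hu).
Local Notation hplane := (hplane sigma s).
Local Notation witt_cls h := (@witt_cls E sigma s h).
Local Notation anisotropic := (@anisotropic E sigma s).

Lemma mxcong_row m n (M : 'M[E]_m) (N : 'M[E]_n) (p : 'rV_n) :
  mxcong sigma M N -> p *m N *m ctr p = 0 -> p != 0 ->
  exists2 q : 'rV_m, q *m M *m ctr q = 0 & q != 0.
Proof.
move=> /mxcong_sym[P [[P' [PP' P'P]] <-]] ep p0.
exists (p *m P); first by rewrite ctrM !mulmxA; rewrite !mulmxA in ep.
by apply: contra p0 => /eqP e; rewrite -[p]mulmx1 -PP' mulmxA e mul0mx.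
Qed.

Lemma anisotropic_iso g h :
  iso_cls g = iso_cls h -> anisotropic g -> anisotropic h.
Proof.
move=> /eqP/iso_clsP gh ag p ep; apply/eqP/negP=> /negP p0.
have [q /ag -> ] := mxcong_row gh ep p0.
by rewrite eqxx.
Qed.

Lemma anisotropic_orthr g h : anisotropic (orth g h) -> anisotropic h.
Proof.
move=> ao p ep.
have : row_mx 0 p *m gram (orth g h) *m ctr (row_mx 0 p) = 0.
  rewrite ctr_row ctr0 mul_row_block !(mul0mx, mulmx0, add0r, addr0).
  by rewrite mul_row_col mul0mx add0r.
by move=> /ao/(congr1 (@rsubmx _ 1 _ _)); rewrite row_mxKr raddf0.
Qed.

Lemma hplane_isotropic : ~ anisotropic hplane.
Proof.
move=> /(_ (row_mx 1%:M 0)); rewrite ctr_row ctr0 mul_row_block.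
rewrite !(mul0mx, mulmx0, add0r, addr0) mul_row_col mulmx0 mul0mx addr0.
move=> /(_ erefl)/(congr1 (@lsubmx _ 1 _ _)); rewrite row_mxKl raddf0.
move=> /matrixP/(_ 0 0); rewrite !mxE /= => /eqP.
by rewrite oner_eq0.
Qed.

Lemma form_dim_iso0 (g : form sigma s) : iso_cls g = 0 -> form_dim g = 0%N.
Proof.
move=> /eqP/iso_clsP[P [[N [PN _]] _]]; move: P N PN.
case: (form_dim g) => // n P N; rewrite [P]thinmx0 mul0mx.
by move=> /matrixP/(_ 0 0); rewrite !mxE => /esym/eqP; rewrite oner_eq0.
Qed.

Lemma iso_cls_dim0 (g : form sigma s) : form_dim g = 0%N -> iso_cls g = 0.
Proof.
case: g => m M Ms Mi /= m0; subst m; apply: iso_cls_eq.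
exists 1%:M; split; first exact: mx_invertible1.
by apply/matrixP=> -[].
Qed.

Lemma iso_cls_eq0l g (x : isoclass sigma s) : iso_cls g + x = 0 -> iso_cls g = 0.
Proof.
elim/iso_cls_ind: x => h; rewrite -iso_clsD => /form_dim_iso0 /eqP.
by rewrite addn_eq0 => /andP[/eqP + _]; exact: iso_cls_dim0.
Qed.

Hypothesis Ediv : division_algebra E.
Hypothesis two_unit : (2%:R : E) \is a GRing.unit.
Variable u0 : E.
Hypothesis u0S : symu u0.

Lemma iso_cls_cancel (x y z : isoclass sigma s) : x + y = x + z -> y = z.
Proof.
elim/iso_cls_ind: x => g; elim/iso_cls_ind: y => h; elim/iso_cls_ind: z => k.
have [us [hu ->]] := diagonalize Ediv u0S two_unit g.
elim: us hu => [|u us IH] hu; first by rewrite diag_nil !add0r.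
have [h1 h2] : all symu [:: u] /\ all symu us by move: hu => /= /andP[-> ->].
rewrite (diag_cons hu h1 h2) -!addrA -!(iso_clsD (diag h2)).
by move=> /(iso_cls_cancel_line Ediv two_unit); rewrite !iso_clsD; exact: IH.
Qed.

Lemma witt_lineN u (hu : all symu [:: u]) (hN : all symu [:: - u]) :
  witt_cls (diag hN) = - witt_cls (diag hu).
Proof.
apply/eqP; rewrite -addr_eq0 addrC -witt_hplane -(@witt_clsD _ _ _ hplane) //.
by rewrite (hplane_split two_unit).
Qed.

(** As - <u> = <- u> in the Witt group and forms are diagonalizable, every element
    is a sum of classes of lines, without subtraction. *)
Lemma witt_line_ind (P : witt sigma s -> Prop) :
  P 0 ->
  (forall u (hu : all symu [:: u]) x, P x -> P (witt_cls (diag hu) + x)) ->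
  forall x, P x.
Proof.
move=> P0 PD; elim/groth_ind=> -[c d].
elim/iso_cls_ind: c => g; elim/iso_cls_ind: d => h.
rewrite [groth_cls _ _]witt_clsB.
have [us [hu eg]] := diagonalize Ediv u0S two_unit g.
have [vs [hv eh]] := diagonalize Ediv u0S two_unit h.
rewrite (witt_cls_eq eg) (witt_cls_eq eh) {g h eg eh}.
elim: us hu => [|u us IH] hu; last first.
  have [h1 h2] : all symu [:: u] /\ all symu us by move: hu => /= /andP[-> ->].
  by rewrite (witt_clsD (diag_cons hu h1 h2)) -addrA; exact/PD/IH.
rewrite (witt_cls0 (diag_nil hu)) add0r.
elim: vs hv => [|v vs IH] hv; first by rewrite (witt_cls0 (diag_nil hv)) oppr0.
have [h1 h2] : all symu [:: v] /\ all symu vs by move: hv => /= /andP[-> ->].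
have hN : all symu [:: - v].
  by rewrite /= andbT; apply: symunitN; move: h1; rewrite /= andbT.
by rewrite (witt_clsD (diag_cons hv h1 h2)) opprD -(witt_lineN h1 hN); exact/PD/IH.
Qed.

(** Add a line <u> to an anisotropic g. If the sum is isotropic, then g represents
    - u, and <u> cancels against the line <- u> that splits off from g. *)
Lemma witt_anisotropic (x : witt sigma s) :
  exists2 g, anisotropic g & x = witt_cls g.
Proof.
elim/witt_line_ind: x => [|u hu x [g ag ->]].
  exists (form0 sigma s); first by move=> p _; rewrite [p]thinmx0.
  by rewrite witt_cls0.
have [ao|] := pselect (anisotropic (orth (diag hu) g)).
  by exists (orth (diag hu) g) => //; apply/esym/witt_clsD/iso_clsD.
move=> /existsNP[p /existsNP[ep /eqP p0]].
have hN : all symu [:: - u].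
  by rewrite /= andbT; apply: symunitN; move: (hu); rewrite /= andbT.
have uu : u \is a GRing.unit by case/andP: (hu) => /andP[].
(* p = (c, q) with c nonzero, as g is anisotropic: so g takes the value - u at c^-1 q *)
pose c := lsubmx p 0 0; pose q := rsubmx p.
have pE : p = row_mx c%:M q.
  rewrite -[LHS]hsubmxK; congr row_mx; apply/matrixP=> i j.
  by rewrite !ord1 [RHS]mxE mulr1n.
have eg : c%:M *m u%:M *m (sigma c)%:M + q *m gram g *m ctr q = 0 :> 'M_1.
  rewrite -[RHS]ep pE ctr_row ctr_scalar /= diag_mx1.
  by rewrite mul_row_block !(mul0mx, mulmx0, add0r, addr0) mul_row_col.
have c0 : c != 0.
  apply: contra p0 => /eqP c0; move: eg.
  rewrite c0 inv0 raddf0 !mul0mx add0r => /ag q0.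
  by rewrite pE c0 q0 raddf0 row_mx0.
have cu := Ediv c0.
have [|h _ eh] := @represented_split _ sigma s Ediv g (c^-1%:M *m q) (- u) hN.
  rewrite ctrM ctr_scalar !mulmxA -!(mulmxA c^-1%:M).
  have -> : q *m gram g *m ctr q = - (c%:M *m u%:M *m (sigma c)%:M).
    by apply/eqP; rewrite -addr_eq0 addrC eg.
  rewrite mulNmx mulmxN !mulmxA -!scalar_mxM mulVr // mul1r.
  by rewrite -mulrA -invM mulVr // inv1 mulr1 raddfN.
exists h.
  apply: (@anisotropic_orthr (diag hN)); apply: anisotropic_iso ag.
  by rewrite iso_clsD.
by rewrite (witt_clsD eh) (witt_lineN hu) addrA subrr add0r.
Qed.

(** If g has class 0, then Witt cancellation makes either the sum of g and some
    hyperbolic planes trivial, or g itself a nontrivial sum of such planes, which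
    is isotropic. *)
Lemma witt_anisotropic_eq0 g :
  anisotropic g -> witt_cls g = 0 -> iso_cls g = 0.
Proof.
move=> ag /eqP/groth_clsP[c [m [n]]]; rewrite /= addr0 !add0r.
rewrite addrAC [LHS]addrC => /iso_cls_cancel.
have [le_nm|lt_mn] := leqP n m.
  rewrite -(subnK le_nm) mulrnDr addrA [LHS]addrC -[RHS]addr0.
  by move=> /iso_cls_cancel; exact: iso_cls_eq0l.
rewrite -(subnK (ltnW lt_mn)) mulrnDr addrC [RHS]addrC => /iso_cls_cancel.
move: lt_mn; rewrite -subn_gt0; case: (n - m)%N => // k _.
rewrite mulrS; elim/iso_cls_ind: (_ *+ k) => h.
rewrite addrC -iso_clsD => e; case: hplane_isotropic.
exact: anisotropic_orthr (anisotropic_iso e ag).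
Qed.

End WittGroup.

(** * Homomorphisms from Witt groups and scaling *)

Section WittUniversal.
Variables (E : unitRingType) (sigma : involution E) (s : bool) (T : zmodType).
Variable G : form sigma s -> T.
Hypothesis G_iso : forall g h, iso_cls g = iso_cls h -> G g = G h.
Hypothesis G_orth : forall g h, G (orth g h) = G g + G h.
Hypothesis G_hplane : G (hplane sigma s) = 0.

Let G' (c : isoclass sigma s) : T := G (repr c).

Let G'E g : G' (iso_cls g) = G g.
Proof. by apply: G_iso; rewrite /iso_cls reprK. Qed.

Let G'D c d : G' (c + d) = G' c + G' d.
Proof.
elim/iso_cls_ind: c => g; elim/iso_cls_ind: d => h.
by rewrite -iso_clsD !G'E G_orth.
Qed.

Let G'0 : G' 0 = 0.
Proof. by apply: (addrI (G' 0)); rewrite -G'D !addr0. Qed.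

Let G'H n : G' (iso_cls (hplane sigma s) *+ n) = 0.
Proof. by elim: n => [|n IH]; rewrite ?mulr0n // mulrS G'D IH addr0 G'E. Qed.

Let f (x : witt sigma s) : T := G' (repr x).1 - G' (repr x).2.

Let fE c d : f (groth_cls (iso_cls (hplane sigma s)) (c, d)) = G' c - G' d.
Proof.
rewrite /f; set p := repr _.
have /groth_clsP[e [m [n]]] : groth_cls (iso_cls (hplane sigma s)) p
    == groth_cls (iso_cls (hplane sigma s)) (c, d).
  by rewrite /groth_cls reprK.
move=> /(congr1 G') /=; rewrite !G'D !G'H !addr0 => /addIr e1.
by apply/eqP; rewrite subr_eq addrAC eq_sym subr_eq eq_sym e1.
Qed.

Let f_zmod : zmod_morphism f.
Proof.
elim/groth_ind=> -[c d]; elim/groth_ind=> -[c' d'].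
rewrite [- _]groth_oppE [_ + _]groth_addE !fE !G'D.
by rewrite !opprD opprK addrACA [G' d' - _]addrC.
Qed.

(** The Witt group is universal among the groups with an additive invariant of
    forms that vanishes on the hyperbolic plane. *)
Lemma witt_universal :
  exists F : {additive witt sigma s -> T}, forall g, F (witt_cls g) = G g.
Proof.
pose fM := GRing.isZmodMorphism.Build _ _ f f_zmod.
pose F : {additive witt sigma s -> T} := HB.pack f fM.
by exists F => g; rewrite [LHS]fE G'E G'0 subr0.
Qed.

End WittUniversal.

(** When the involutions differ by conjugation with c, right multiplication of the
    Gram matrices by c turns eps'-hermitian forms for sigma' into eps-hermitian
    forms for sigma. This serves below for c = pi, with both involutions equal, and
    for c = x, between tau_x and tau. *)
Section Scale.
Variables (E : unitRingType) (sigma' sigma : involution E) (s' s : bool) (c : E).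
Hypothesis cu : c \is a GRing.unit.
Hypothesis sigma'E : forall e, sigma' e = c * sigma e * c^-1.
Hypothesis sigma_c : sigma c = (-1) ^+ s * (-1) ^+ s' * c.

Lemma mulmx_scalar_entry m n (M : 'M[E]_(m, n)) i j : (M *m c%:M) i j = M i j * c.
Proof.
rewrite mxE (bigD1 j) //= mxE eqxx mulr1n big1 ?addr0 // => k kj.
by rewrite mxE (negPf kj) mulr0n mulr0.
Qed.

Lemma ctr_scale m n (M : 'M[E]_(m, n)) :
  ctr sigma' M *m c%:M = c%:M *m ctr sigma M.
Proof.
rewrite mul_scalar_mx; apply/matrixP=> i j.
by rewrite mulmx_scalar_entry !mxE sigma'E mulrVK.
Qed.

Lemma scale_sym (g : form sigma' s') :
  ctr sigma (gram g *m c%:M) = (-1) ^+ s *: (gram g *m c%:M).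
Proof.
rewrite ctrM ctr_scalar sigma_c scalar_mxM -mulmxA -ctr_scale gram_sym.
rewrite -scalemxAl mul_scalar_mx scalerA.
by rewrite -mulrA -signr_addb addbb mulr1.
Qed.

Lemma scale_nondeg (g : form sigma' s') : mx_invertible (gram g *m c%:M).
Proof. by apply: mx_invertibleM (gram_nondeg g) _; apply: mx_invertible_scalar. Qed.

Definition scale_form (g : form sigma' s') : form sigma s :=
  Form (scale_sym g) (scale_nondeg g).

Lemma scale_form_iso g h :
  iso_cls g = iso_cls h -> iso_cls (scale_form g) = iso_cls (scale_form h).
Proof.
move=> /eqP/iso_clsP[P [Pi eP]]; apply: iso_cls_eq; exists P; split=> //=.
by rewrite -eP -!mulmxA ctr_scale.
Qed.

Lemma scale_form_orth g h :
  iso_cls (scale_form (orth g h)) = iso_cls (scale_form g) + iso_cls (scale_form h).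
Proof.
rewrite -iso_clsD; apply: iso_cls_eq; exists 1%:M; split.
  exact: mx_invertible1.
rewrite ctr1 mul1mx mulmx1 /= scalar_mx_block.
by rewrite mulmx_block !(mul0mx, mulmx0, addr0, add0r).
Qed.

Lemma scale_form_hplane :
  iso_cls (scale_form (hplane sigma' s')) = iso_cls (hplane sigma s).
Proof.
apply: iso_cls_eq; apply: mxcong_sym.
exists (block_mx c^-1%:M 0 0 1%:M); split.
  apply: mx_invertible_block; last exact: mx_invertible1.
  by apply: mx_invertible_scalar; rewrite unitrV.
rewrite /= ctr_block !ctr0 ctr1 ctr_scalar scalar_mx_block.
rewrite !mulmx_block !(mul0mx, mulmx0, addr0, add0r, mulmx1, mul1mx).
rewrite -!scalar_mxM mulVr //; congr (block_mx _ _ _%:M _).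
have -> : (-1) ^+ s' * c = (-1) ^+ s * sigma c.
  by rewrite sigma_c !mulrA -signr_addb addbb mul1r.
by rewrite -mulrA -invM mulVr // inv1 mulr1.
Qed.

Lemma scale_form_diag us (hu : all (symunit sigma' s') us)
    (hu' : all (symunit sigma s) [seq u * c | u <- us]) :
  iso_cls (scale_form (diag_form hu)) = iso_cls (diag_form hu').
Proof.
elim: us hu hu' => [|u us IH] hu hu'.
  by rewrite diag_nil; apply: iso_cls_dim0.
have [h1 h2] : all (symunit sigma' s') [:: u] /\ all (symunit sigma' s') us.
  by move: hu => /= /andP[-> ->].
have [h1' h2'] : all (symunit sigma s) [:: u * c]
    /\ all (symunit sigma s) [seq u * c | u <- us].
  by move: hu' => /= /andP[-> ->].
have e : iso_cls (scale_form (diag_form hu))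
   = iso_cls (scale_form (orth (diag_form h1) (diag_form h2))).
  by apply: scale_form_iso; rewrite iso_clsD; apply: diag_cons.
rewrite e scale_form_orth (diag_cons hu' h1' h2') (IH h2 h2'); congr (_ + _).
apply: iso_cls_eq; exists 1%:M; split; first exact: mx_invertible1.
by rewrite ctr1 mul1mx mulmx1 /= !diag_mx1 -scalar_mxM.
Qed.

Lemma symunit_scale u : symunit sigma' s' u -> symunit sigma s (u * c).
Proof.
move=> /andP[/eqP su uu]; apply/andP; split; last by rewrite unitrMl.
have cs : c * sigma u = (-1) ^+ s' * u * c by rewrite -su sigma'E mulrVK.
apply/eqP; rewrite invM sigma_c -(mulrA _ c) cs !mulrA -(mulrA _ _ ((-1) ^+ s')).
by rewrite -signr_addb addbb mulr1.
Qed.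

Lemma witt_scale : exists F : {additive witt sigma' s' -> witt sigma s},
  forall g, F (witt_cls g) = witt_cls (scale_form g).
Proof.
apply: witt_universal => [g h e|g h|].
- by apply: witt_cls_eq; apply: scale_form_iso.
- by apply: witt_clsD; apply: scale_form_orth.
- by rewrite (witt_cls_eq scale_form_hplane) witt_hplane.
Qed.

End Scale.

(** * Square roots of 1-units in a complete valued field *)

Section Valuation.
Variables (K : fieldType) (v : dvaluation K).
Local Notation vring := (vring v).
Local Notation vmax := (vmax v).
Local Notation vred := (vred v).

(** The n-th power of the maximal ideal, for n in int; vge 0 is the valuation ring. *)
Definition vge (n : int) (x : K) : bool := (x == 0) || (n <= v x).

Lemma vge_le m n x : m <= n -> vge n x -> vge m x.
Proof. by move=> mn /orP[/eqP ->|h]; rewrite /vge ?eqxx // (le_trans mn h) orbT. Qed.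

Lemma vgeN n x : vge n (- x) = vge n x.
Proof. by rewrite /vge oppr_eq0 dvalN. Qed.

Lemma vge0 n : vge n 0. Proof. by rewrite /vge eqxx. Qed.

Lemma vgeD n x y : vge n x -> vge n y -> vge n (x + y).
Proof.
have [->|x0] := eqVneq x 0; first by rewrite add0r.
have [->|y0] := eqVneq y 0; first by rewrite addr0.
rewrite /vge (negPf x0) (negPf y0) /= => hx hy.
have [//|s0 /=] := eqVneq (x + y) 0.
by apply: le_trans (dvalD v x0 y0 s0); rewrite le_min hx.
Qed.

Lemma vgeB n x y : vge n x -> vge n y -> vge n (x - y).
Proof. by move=> hx hy; apply: vgeD; rewrite ?vgeN. Qed.

Lemma vgeM m n x y : vge m x -> vge n y -> vge (m + n) (x * y).
Proof.
rewrite /vge mulf_eq0; have [//|x0] := eqVneq x 0; have [//|y0 /=] := eqVneq y 0.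
by move=> hx hy; rewrite dvalM // lerD.
Qed.

Lemma vgeZ n c x : c != 0 -> vge n (c * x) = vge (n - v c) x.
Proof.
move=> c0; rewrite /vge mulf_eq0 (negPf c0) /=; have [//|x0 /=] := eqVneq x 0.
by rewrite dvalM // lerBlDl.
Qed.

Lemma vringE x : (x \in vring) = vge 0 x. Proof. by []. Qed.
Lemma vmaxE x : (x \in vmax) = vge 1 x. Proof. by []. Qed.

Lemma vge_all x : (forall n, vge n x) -> x = 0.
Proof.
move=> h; have := h (v x + 1); rewrite /vge => /orP[/eqP //|].
by rewrite gerDl.
Qed.

Lemma vred0 : vred 0 = 0.
Proof. by apply/eqP; rewrite vred_eq0 ?unfold_in ?eqxx. Qed.

Lemma vredD : {in vring &, {morph vred : x y / x + y}}.
Proof.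
move=> x y hx hy.
rewrite -[x](insubdK (0 : valring v) hx) -[y](insubdK (0 : valring v) hy).
by rewrite -rmorphD !vred_val rmorphD.
Qed.

Lemma vredN x : x \in vring -> vred (- x) = - vred x.
Proof.
move=> hx; apply/eqP; rewrite -addr_eq0 -vredD ?addNr ?vred0 //.
by rewrite vringE vgeN.
Qed.

Lemma vred_surj e : exists2 x, x \in vring & vred x = e.
Proof.
exists (val (repr e)); first exact: valP.
by rewrite vred_val reprK.
Qed.

Lemma vred_neq0 x : x \in vring -> vred x != 0 -> x != 0 /\ v x = 0.
Proof.
move=> hx; rewrite vred_eq0 // vmaxE /vge negb_or => /andP[x0 xv]; split=> //.
move: hx; rewrite vringE /vge (negPf x0) /= => hx.
by apply/eqP; rewrite eq_le hx andbT leNgt.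
Qed.

Lemma vredX x n : x \in vring -> vred (x ^+ n) = vred x ^+ n.
Proof.
move=> hx; elim: n => [|n IH]; first exact: vred1.
by rewrite !exprS vredM ?IH // rpredX.
Qed.

Lemma vredV x : x \in vring -> vred x != 0 ->
  x^-1 \in vring /\ vred x^-1 = (vred x)^-1.
Proof.
move=> hx x1; have [x0 vx] := vred_neq0 hx x1.
have hV : x^-1 \in vring by rewrite vringE /vge dvalV // vx oppr0 lexx orbT.
split=> //; apply: (mulfI x1).
by rewrite mulfV // -vredM // mulfV // vred1.
Qed.

Hypothesis v_complete : vcomplete v.
Hypothesis k_char : 2 \notin [pchar residue_field v].

Lemma two_vring : 2%:R \in vring. Proof. exact: rpred_nat. Qed.

Lemma vred2 : vred 2%:R != 0.
Proof.
have -> : vred 2%:R = 2%:R.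
  by rewrite mulr2n vredD ?rpred1 // vred1 -mulr2n.
by apply: contra k_char; rewrite inE.
Qed.

(** Hensel's lemma for T^2 - t at the root 1 modulo the maximal ideal. The step
    e - (e^2 - t)/2 is Newton's with the derivative 2 e replaced by its value 2 modulo
    the maximal ideal, so each step gains one power of the maximal ideal. *)
Lemma one_unit_sqrt t : t \in vring -> vred t = 1 ->
  exists e, [/\ e \in vring, vred e = 1 & e ^+ 2 = t].
Proof.
move=> ht t1.
have [two0 _] := vred_neq0 two_vring vred2.
have [h2 _] := vredV two_vring vred2.
have half n x : vge n x -> vge n (x / 2%:R).
  by move=> hx; rewrite -[n]addr0; apply: vgeM.
pose e := fix e n : K := if n is n'.+1 then e n' - (e n' ^+ 2 - t) / 2%:R else 1.
have eS n : e n.+1 = e n - (e n ^+ 2 - t) / 2%:R by [].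
have he n : vge 1 (e n - 1) /\ vge n.+1%:Z (e n ^+ 2 - t).
  elim: n => [|n [IH1 IH2]].
    rewrite /= subrr vge0 expr1n -vmaxE -vred_eq0; last by rewrite rpredB ?rpred1.
    by rewrite vredD ?rpred1 ?rpredN // vred1 vredN // t1 subrr eqxx.
  rewrite eS; set d := e n ^+ 2 - t; split.
    rewrite addrAC; apply: vgeB => //; apply: half.
    by apply: vge_le IH2; rewrite lez_nat.
  have -> : (e n - d / 2%:R) ^+ 2 - t = (d / 2%:R) * (d / 2%:R) - (e n - 1) * d.
    by rewrite /d; field.
  apply: vgeB; last first.
    by rewrite -[X in vge X _]/((1 + n.+1)%N%:Z) PoszD; apply: vgeM.
  have hh : vge (n.+1%:Z + n.+1%:Z) (d / 2%:R * (d / 2%:R)).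
    by apply: vgeM; apply: half.
  by apply: vge_le hh; rewrite -PoszD lez_nat addSn ltnS leq_addl.
have hm m n : (n <= m)%N -> vge n.+1%:Z (e m - e n).
  move=> /subnK <-; elim: (m - n)%N => [|k IH]; first by rewrite subrr vge0.
  rewrite addSn eS addrAC; apply: vgeB => //; apply: half.
  by case: (he (k + n)%N) => _; apply: vge_le; rewrite lez_nat ltnS leq_addl.
have [l hl] : exists l, forall N, exists M, forall n, (M <= n)%N -> vge N (e n - l).
  have [N|l hl] := v_complete (u := e); last first.
    exists l => N; have [M hM] := hl N; exists M => n /hM.
    by rewrite /vge => -[->|->]; rewrite ?eqxx ?orbT.
  exists `|N|%N => m n hm1 hn1.
  have : vge N (e m - e n).
    have NN : N <= (`|N|%N)%:Z by rewrite abszE ler_norm.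
    have [le|/ltnW le] := leqP n m.
      apply: vge_le (hm _ _ le); apply: le_trans NN _.
      by rewrite lez_nat leqW.
    rewrite -vgeN opprB; apply: vge_le (hm _ _ le); apply: le_trans NN _.
    by rewrite lez_nat leqW.
  by move=> /orP[/eqP|]; [left|right].
have evr n : e n \in vring.
  rewrite -[e n](subrK 1) rpredD ?rpred1 // vringE.
  by case: (he n) => + _; apply: vge_le.
have l1 : vge 1 (l - 1).
  have [M hM] := hl 1; rewrite -[l](subrK (e M)) -addrA.
  by apply: vgeD; [rewrite -vgeN opprB; exact: hM | case: (he M)].
have lvr : l \in vring.
  by rewrite -[l](subrK 1) rpredD ?rpred1 // vringE; apply: vge_le l1.
exists l; split=> //.
  apply/eqP; rewrite -subr_eq0 -vred1 -vredN ?rpred1 // -vredD ?rpredN ?rpred1 //.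
  by rewrite vred_eq0 ?rpredB ?rpred1.
apply/eqP; rewrite -subr_eq0; apply/eqP/vge_all => N.
have [M hM] := hl N; pose n := maxn M `|N|%N.
have -> : l ^+ 2 - t = (l + e n) * (l - e n) + (e n ^+ 2 - t) by ring.
apply: vgeD.
  rewrite -[N]add0r; apply: vgeM; first by rewrite -vringE rpredD.
  by rewrite -vgeN opprB; apply: hM; rewrite leq_maxl.
case: (he n) => _; apply: vge_le; apply: le_trans (ler_norm N) _.
by rewrite -abszE lez_nat leqW // leq_maxr.
Qed.

(** Divide by a nonzero member of least valuation. *)
Lemma common_scale (J : finType) (g : J -> K) j0 : g j0 != 0 ->
  exists2 c, c != 0 &
    (forall j, c * g j \in vring) /\ exists j, vred (c * g j) != 0.
Proof.
move=> g0.
case: (@Order.TotalTheory.arg_minP _ _ _ j0 (fun j => g j != 0) (fun j => v (g j)) g0).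
move=> j gj jmin.
exists (g j)^-1; first by rewrite invr_eq0.
split=> [i|]; last by exists j; rewrite mulVf // vred1 oner_neq0.
rewrite vringE vgeZ ?invr_eq0 // dvalV // opprK add0r /vge.
by have [//|gi /=] := eqVneq (g i) 0; apply: jmin.
Qed.

End Valuation.

(** * Norms and conjugation of quaternions *)

Section QuaternionAlgebra.
Variables (F : fieldType) (a b : F).
Local Notation Q := (quat a b).
Implicit Types d e : Q.
Local Notation conj := (@quat_conj F a b).
Local Notation nrd := (@quat_nrd F a b).

Lemma quat_conj_nrd d : d * conj d = (nrd d)%:A.
Proof. by apply: quatP; split; rewrite /quat_nrd /=; ring. Qed.

Lemma quat_nrdZ c d : nrd (c *: d) = c ^+ 2 * nrd d.
Proof. by rewrite /quat_nrd /=; ring. Qed.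

Lemma quat_nrdM d e : nrd (d * e) = nrd d * nrd e.
Proof. by rewrite /quat_nrd /=; ring. Qed.

Lemma quat_conjZ c d : conj (c *: d) = c *: conj d.
Proof. by apply: quatP; split; rewrite /= ?mulrN. Qed.

Lemma quat_conj_eq0 d : conj d = 0 -> d = 0.
Proof. by move=> e; rewrite -[d]quat_conjK e; apply: quatP; split; rewrite /= ?oppr0. Qed.

Lemma quat_div_nrd d : division_algebra Q -> d != 0 -> nrd d != 0.
Proof.
move=> Qdiv d0; apply: contra (d0) => /eqP n0.
have := quat_conj_nrd d; rewrite n0 scale0r => e.
apply/eqP/quat_conj_eq0; apply: (mulrI (Qdiv d d0)).
by rewrite e mulr0.
Qed.

Lemma quat_nrd_unit d : nrd d != 0 ->
  d \is a GRing.unit /\ d^-1 = (nrd d)^-1 *: conj d.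
Proof.
move=> n0; have dc : d * ((nrd d)^-1 *: conj d) = 1.
  by rewrite -scalerAr quat_conj_nrd scalerA mulVf // scale1r.
have cd : (nrd d)^-1 *: conj d * d = 1.
  rewrite -scalerAl -{3}[d]quat_conjK quat_conj_nrd.
  have -> : nrd (conj d) = nrd d by rewrite /quat_nrd /=; ring.
  by rewrite scalerA mulVf // scale1r.
have du : d \is a GRing.unit by apply/unitrP; exists ((nrd d)^-1 *: conj d).
by split=> //; apply: (mulrI du); rewrite mulrV.
Qed.

Lemma quat_nrd_div : (forall d, nrd d = 0 -> d = 0) -> division_algebra Q.
Proof.
move=> h d d0; have n0 : nrd d != 0 by apply: contra d0 => /eqP /h ->.
by have [] := quat_nrd_unit n0.
Qed.

Lemma quat_pure_sq d : conj d = - d -> d * d = - (nrd d)%:A.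
Proof. by move=> h; rewrite -quat_conj_nrd h mulrN opprK. Qed.

Lemma quat_pureP d : (2%:R : F) != 0 -> (conj d == - d) = (q1 d == 0).
Proof.
move=> two; apply/eqP/eqP => [/(congr1 (@q1 F a b))/= /eqP|h].
  by rewrite -addr_eq0 -mulr2n -mulr_natl mulf_eq0 (negPf two) => /eqP.
by apply: quatP; split; rewrite //= h oppr0.
Qed.

(** Pure quaternions c u and w of the same norm have the same square, so that
    w + c u conjugates one into the other:
    (w + c u) c u = w c u + w w = w (w + c u).
    With p a multiple of (w + c u) u this reads p u conj(p) = w, once the scalar l
    makes the norms agree. *)
Lemma quat_pure_conj (u w : Q) (c l : F) :
  conj u = - u -> conj w = - w -> nrd w = c ^+ 2 * nrd u ->
  let p := l *: ((w + c *: u) * u) in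
  l ^+ 2 * nrd u * nrd (w + c *: u) = c -> c != 0 ->
  p * u * conj p = w.
Proof.
move=> hu hw hn p hl c0.
have ew : (w + c *: u) * u = c^-1 *: (w * (w + c *: u)).
  apply: (scalerI c0); rewrite scalerA divff // scale1r mulrDl mulrDr scalerDr.
  rewrite -scalerAl (quat_pure_sq hu) (quat_pure_sq hw) hn -scalerAr addrC.
  by rewrite !scalerN !scalerA -expr2 addrC addrC.
have -> : p * u * conj p = l ^+ 2 *: ((w + c *: u) * u * u * conj u * conj (w + c *: u)).
  rewrite /p quat_conjZ -!(scalerAl, scalerAr) scalerA -expr2 quat_conjM.
  by rewrite !mulrA.
rewrite -(mulrA ((w + c *: u) * u)) quat_conj_nrd -scalerAr mulr1.
rewrite ew -!scalerAl -mulrA quat_conj_nrd -scalerAr mulr1 !scalerA.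
rewrite -[RHS]scale1r; congr (_ *: _).
rewrite -(divff c0) -[X in _ = X / _]hl; ring.
Qed.

End QuaternionAlgebra.

(** * Reduction of quaternions *)

Section ValuedQuaternion.
Variables (K : fieldType) (v : dvaluation K) (a b : K).
Hypothesis v_complete : vcomplete v.
Hypothesis k_char : 2 \notin [pchar residue_field v].
Hypotheses (ha : a \in vunit v) (hb : b \in vunit v).
Hypothesis D_division : division_algebra (quat a b).

Local Notation D := (quat a b).
Local Notation Db := (quat (vred v a) (vred v b)).
Local Notation qred := (qred v a b).
Local Notation vred := (vred v).
Local Notation vring := (vring v).
Local Notation nu := (nuD v a b).
Implicit Types d e u w : D.

(** The n-th power of m_D, described by coordinates; ODE and mDE identify qge 0 and
    qge 1 with O_D and m_D. *)
Definition qge (n : int) d : bool :=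
  [&& vge v n (q1 d), vge v n (qx d), vge v n (qy d) & vge v n (qz d)].

Lemma qgeP n d : reflect
  [/\ vge v n (q1 d), vge v n (qx d), vge v n (qy d) & vge v n (qz d)] (qge n d).
Proof. exact: and4P. Qed.

Lemma qge0 n : qge n 0.
Proof. by rewrite /qge /= !vge0. Qed.

Lemma a_vring : a \in vring. Proof. by case/and3P: ha. Qed.
Lemma b_vring : b \in vring. Proof. by case/and3P: hb. Qed.

Lemma qgeD n d e : qge n d -> qge n e -> qge n (d + e).
Proof.
move=> /qgeP[? ? ? ?] /qgeP[? ? ? ?]; apply/qgeP; split; exact: vgeD.
Qed.

Lemma qgeN n d : qge n (- d) = qge n d.
Proof. by rewrite /qge /= !vgeN. Qed.

Lemma qgeM d e : qge 0 d -> qge 0 e -> qge 0 (d * e).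
Proof.
move=> /qgeP[? ? ? ?] /qgeP[? ? ? ?]; have := a_vring; have := b_vring => ? ?.
by apply/qgeP; split; rewrite -vringE /= !(rpredB, rpredD, rpredM).
Qed.

Lemma qgeZ n c d : c != 0 -> qge n (c *: d) = qge (n - v c) d.
Proof. by move=> c0; rewrite /qge /= !vgeZ. Qed.

Lemma qge1 : qge 0 1.
Proof. by rewrite /qge /= !vge0 -vringE rpred1. Qed.

Lemma qge_conj n d : qge n (quat_conj d) = qge n d.
Proof. by rewrite /qge /= !vgeN. Qed.

Lemma nrd_vring d : qge 0 d -> quat_nrd d \in vring.
Proof.
move=> /qgeP[? ? ? ?]; have := a_vring; have := b_vring => ? ?.
by rewrite /quat_nrd !(rpredB, rpredD, rpredM, rpredX).
Qed.

Lemma qred0 : qred 0 = 0.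
Proof. by apply: quatP; rewrite /= vred0. Qed.

Lemma qredD d e : qge 0 d -> qge 0 e -> qred (d + e) = qred d + qred e.
Proof.
move=> /qgeP[? ? ? ?] /qgeP[? ? ? ?].
by apply: quatP; rewrite /= !vredD.
Qed.

Lemma qredN d : qge 0 d -> qred (- d) = - qred d.
Proof. by move=> /qgeP[? ? ? ?]; apply: quatP; rewrite /= !vredN. Qed.

Lemma qredZ c d : c \in vring -> qge 0 d -> qred (c *: d) = vred c *: qred d.
Proof. by move=> ? /qgeP[? ? ? ?]; apply: quatP; rewrite /= !vredM. Qed.

Lemma qred1 : qred 1 = 1.
Proof. by apply: quatP; rewrite /= vred1 vred0. Qed.

Lemma qred_conj d : qge 0 d -> qred (quat_conj d) = quat_conj (qred d).
Proof. by move=> /qgeP[? ? ? ?]; apply: quatP; rewrite /= !vredN. Qed.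

Ltac vred_push :=
  rewrite !(vredD, vredN, vredM, vredX) ?(rpredD, rpredN, rpredM, rpredX) //.

Lemma qredM d e : qge 0 d -> qge 0 e -> qred (d * e) = qred d * qred e.
Proof.
move=> /qgeP[? ? ? ?] /qgeP[? ? ? ?]; have := a_vring; have := b_vring => ? ?.
by apply: quatP; split; rewrite /=; vred_push.
Qed.

Lemma qred_nrd d : qge 0 d -> vred (quat_nrd d) = quat_nrd (qred d).
Proof.
move=> /qgeP[? ? ? ?]; have := a_vring; have := b_vring => ? ?.
by rewrite /quat_nrd /=; vred_push.
Qed.

Lemma qred_surj (e : Db) : exists2 d, qge 0 d & qred d = e.
Proof.
case: e => e1 ex ey ez.
have [d1 h1 <-] := vred_surj e1; have [dx h2 <-] := vred_surj ex.
have [dy h3 <-] := vred_surj ey; have [dz h4 <-] := vred_surj ez.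
by exists (Quat a b d1 dx dy dz) => //; apply/qgeP; split.
Qed.

Lemma qred_eq0 d : qge 0 d -> (qred d == 0) = qge 1 d.
Proof.
move=> /qgeP[h1 h2 h3 h4]; apply/eqP/qgeP.
  move=> e; have [e1 e2 e3 e4] : [/\ vred (q1 d) = 0, vred (qx d) = 0,
    vred (qy d) = 0 & vred (qz d) = 0] by case: e.
  by split; rewrite -vmaxE -vred_eq0 // ?e1 ?e2 ?e3 ?e4.
move=> [g1 g2 g3 g4]; apply: quatP; split; rewrite /=; apply/eqP;
  by rewrite vred_eq0.
Qed.

(** An isotropic vector of the residual norm form whose first coordinate is nonzero
    would lift: multiply the first coordinate of any lift by the square root of a
    1-unit that makes the norm vanish. *)
Lemma residue_nrd_q1 (e : Db) : q1 e != 0 -> quat_nrd e != 0.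
Proof.
have [d hd <-] := qred_surj e => d1; apply/negP => /eqP.
case/qgeP: (hd) => /= hd1 _ _ _.
rewrite -qred_nrd // => n0; have [d10 vd1] := vred_neq0 hd1 d1.
have [hV _] := vredV hd1 d1.
pose m := quat_nrd d / q1 d ^+ 2.
have hm : m \in vring by rewrite rpredM ?nrd_vring // -exprVn rpredX.
have m0 : vred m = 0.
  by rewrite /m vredM ?nrd_vring ?n0 ?mul0r // -exprVn rpredX.
have [||r [hr r1 er]] := one_unit_sqrt v_complete k_char (t := 1 - m).
- by rewrite rpredB ?rpred1.
- by rewrite vredD ?rpred1 ?rpredN // vred1 vredN // m0 subr0.
have r0 : r != 0 by apply: contraTneq (oner_neq0 (residue_field v)) => r0;
  rewrite -r1 r0 vred0 eqxx.
pose d' := Quat a b (q1 d * r) (qx d) (qy d) (qz d).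
have d'0 : d' != 0.
  by apply: contraTneq (mulf_neq0 d10 r0) => /(congr1 (@q1 _ _ _)) /= ->; rewrite eqxx.
have := quat_div_nrd D_division d'0; apply/negP; rewrite negbK.
rewrite /quat_nrd /= exprMn er /m /quat_nrd; apply/eqP; field.
by [].
Qed.

(** Multiplying by x, y or z brings any nonzero coordinate to the first place. *)
Lemma residue_division : division_algebra Db.
Proof.
have a0 : vred a != 0 := vred_unit_neq0 ha.
have b0 : vred b != 0 := vred_unit_neq0 hb.
apply: quat_nrd_div => e en.
have key (f : Db) : q1 (e * f) = 0.
  by apply/eqP/negPn/negP => /residue_nrd_q1; rewrite quat_nrdM en mul0r eqxx.
apply: quatP; split=> /=.
- by have := key 1; rewrite mulr1.
- have := key (quatx _ _) => /= /eqP; rewrite !(mulr0, mulr1, add0r, addr0, subr0).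
  by rewrite mulf_eq0 (negPf a0) => /eqP.
- have := key (quaty _ _) => /= /eqP; rewrite !(mulr0, mulr1, add0r, addr0, subr0).
  by rewrite mulf_eq0 (negPf b0) => /eqP.
- have := key (quatz _ _) => /= /eqP; rewrite !(mulr0, mulr1, add0r, addr0, sub0r).
  by rewrite oppr_eq0 !mulf_eq0 (negPf a0) (negPf b0) => /eqP.
Qed.

Lemma nuDZ c d : c != 0 -> d != 0 -> nu (c *: d) = (v c)%:~R + nu d.
Proof.
move=> c0 d0; have n0 := quat_div_nrd D_division d0.
rewrite /nuD quat_nrdZ dvalM ?expf_neq0 // expr2 dvalM //.
by rewrite !rmorphD /=; field.
Qed.

Lemma nuD_unit u : qge 0 u -> qred u != 0 -> nu u = 0.
Proof.
move=> hu u0; have [] := vred_neq0 (nrd_vring hu).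
  by rewrite qred_nrd //; exact: quat_div_nrd residue_division u0.
by move=> _ ve; rewrite /nuD ve mul0r.
Qed.

Lemma row_scale n (p : 'rV[D]_n) : p != 0 ->
  exists2 c : K, c != 0 &
    (forall j, qge 0 (c *: p 0 j)) /\ exists j, qred (c *: p 0 j) != 0.
Proof.
move=> p0; pose g (j : 'I_n * 'I_4) : K := quat_row (p 0 j.1) 0 j.2.
have gE j : [/\ g (j, inord 0) = q1 (p 0 j), g (j, inord 1) = qx (p 0 j),
    g (j, inord 2) = qy (p 0 j) & g (j, inord 3) = qz (p 0 j)].
  by rewrite /g !mxE !inordK.
have [j gj] : exists j, g j != 0.
  apply/existsP; apply: contraNT p0; rewrite negb_exists => /forallP gn.
  have gn' j : g j = 0 by have := gn j; rewrite negbK => /eqP.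
  apply/eqP/rowP=> j; rewrite mxE; have [] := gE j; rewrite !gn' => *.
  exact: quatP.
have [c c0 [hc [[i l] hi]]] := common_scale v gj; exists c => //; split.
  by move=> i'; have [e1 e2 e3 e4] := gE i'; apply/qgeP;
    split=> /=; rewrite -?e1 -?e2 -?e3 -?e4; exact: hc.
exists i; apply: contra hi => /eqP e.
have [e1 e2 e3 e4] := gE i.
have {e} [f1 f2 f3 f4] : [/\ vred (c * q1 (p 0 i)) = 0, vred (c * qx (p 0 i)) = 0,
    vred (c * qy (p 0 i)) = 0 & vred (c * qz (p 0 i)) = 0] by case: e.
by case: l => -[|[|[|[|//]]]] hl; rewrite /g mxE /= ?f1 ?f2 ?f3 ?f4.
Qed.

Lemma quat_unit_part d : d != 0 ->
  exists c u, [/\ c != 0, d = c *: u, qge 0 u & qred u != 0].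
Proof.
move=> d0; have [|c c0 [hc [j hj]]] := @row_scale 1 (const_mx d).
  by apply: contra d0 => /eqP/rowP/(_ 0); rewrite !mxE => ->.
exists c^-1, (c *: d); split.
- by rewrite invr_eq0.
- by rewrite scalerA mulVf // scale1r.
- by have := hc 0; rewrite mxE.
- by move: hj; rewrite mxE.
Qed.

Lemma qge_unit n u : qge 0 u -> qred u != 0 -> qge n u = (n <= 0).
Proof.
move=> hu u0; apply/idP/idP => [hn|n0].
  rewrite leNgt; apply: contra u0 => n0; rewrite gtz0_ge1 in n0; rewrite qred_eq0 //.
  by case/qgeP: hn => *; apply/qgeP; split; apply: vge_le n0 _.
by case/qgeP: hu => *; apply/qgeP; split; apply: vge_le n0 _.
Qed.

(** The residual norm form is anisotropic, so the norm of a quaternion that does not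
    reduce to 0 is a unit; hence nu_D is the least valuation of a coordinate. *)
Lemma nuD_int d : d != 0 ->
  exists2 m : int, nu d = m%:~R & forall n, qge n d = (n <= m).
Proof.
move=> /quat_unit_part[c [u [c0 -> hu u0]]]; exists (v c).
  rewrite nuDZ // ?nuD_unit ?addr0 //.
  by apply: contra u0 => /eqP ->; rewrite qred0.
by move=> n; rewrite qgeZ // qge_unit // subr_le0.
Qed.

Lemma ODE d : (d \in OD v a b) = qge 0 d.
Proof.
rewrite unfold_in; have [->|d0 /=] := eqVneq d 0.
  by rewrite qge0.
by have [m -> ->] := nuD_int d0; rewrite ler0z.
Qed.

Lemma mDE d : (d \in mD v a b) = qge 1 d.
Proof.
rewrite unfold_in; have [->|d0 /=] := eqVneq d 0.
  by rewrite qge0.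
by have [m -> ->] := nuD_int d0; rewrite ltr0z.
Qed.

Lemma nuD0 u : u != 0 -> nu u = 0 -> qge 0 u /\ qred u != 0.
Proof.
move=> u0; have [m -> hm] := nuD_int u0 => /eqP; rewrite intr_eq0 => /eqP m0.
have h0 : qge 0 u by rewrite hm m0.
by split=> //; rewrite qred_eq0 // hm m0.
Qed.

(** Hensel's lemma for lines. The norms of u and w have a 1-unit as quotient, which
    is a square c^2; then c u and w are conjugate by quat_pure_conj. The scalar
    needed there involves the root of another 1-unit, as w + c u reduces to twice
    the reduction of u. *)
Lemma skew_lift u w : qge 0 u -> qge 0 w ->
  quat_conj u = - u -> quat_conj w = - w -> qred u = qred w -> qred u != 0 ->
  exists2 p, p != 0 & p * u * quat_conj p = w.
Proof.
move=> hu hw su sw uw u0.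
have nu0 : vred (quat_nrd u) != 0.
  by rewrite qred_nrd //; exact: quat_div_nrd residue_division u0.
have nw0 : vred (quat_nrd w) = vred (quat_nrd u) by rewrite !qred_nrd // uw.
have [Nu vNu] := vred_neq0 (nrd_vring hu) nu0.
have [hV eV] := vredV (nrd_vring hu) nu0.
have [||c [hc c1 ec]] :=
    one_unit_sqrt v_complete k_char (t := quat_nrd w / quat_nrd u).
- by rewrite rpredM ?nrd_vring.
- by rewrite vredM ?nrd_vring // eV nw0 mulfV.
have c1' : vred c != 0 by rewrite c1 oner_neq0.
have [c0 _] := vred_neq0 hc c1'.
have [hcV ecV] := vredV hc c1'.
have [two0 _] := vred_neq0 (two_vring v) (vred2 k_char).
have [h2 e2] := vredV (two_vring v) (vred2 k_char).
pose p0 := w + c *: u.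
have hcu : qge 0 (c *: u).
  by case/qgeP: hu => *; apply/qgeP; split; rewrite -vringE /= rpredM.
have hp0 : qge 0 p0 by apply: qgeD.
have ep0 : qred p0 = vred 2%:R *: qred u.
  rewrite qredD // qredZ // -uw c1 -{1}[qred u]scale1r -scalerDl; congr (_ *: _).
  by rewrite [in RHS]mulr2n vredD ?rpred1 // vred1.
have np0 : vred (quat_nrd p0) = vred 2%:R ^+ 2 * vred (quat_nrd u).
  by rewrite !qred_nrd // ep0 quat_nrdZ.
pose t := quat_nrd p0 * (quat_nrd u)^-1 * c^-1 * (2%:R^-1) ^+ 2.
have [||e [he e1 ee]] := one_unit_sqrt v_complete k_char (t := t).
- by rewrite !rpredM ?nrd_vring ?rpredX.
- rewrite /t !vredM ?(rpredM, rpredX, nrd_vring) // eV ecV e2 np0 c1.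
  rewrite invr1 mulr1 mulfK // -invfM -expr2 mulfV //.
  by rewrite expf_neq0 // vred2.
have e0 : e != 0.
  by apply: contraTneq (oner_neq0 (residue_field v)) => e0; rewrite -e1 e0 vred0 eqxx.
have Np0 : quat_nrd p0 != 0.
  by apply: contra e0 => /eqP N0; move: ee; rewrite /t N0 !mul0r => /eqP; rewrite sqrf_eq0.
have ew : quat_nrd w = c ^+ 2 * quat_nrd u by rewrite ec mulfVK.
pose l := (2%:R * quat_nrd u * e)^-1.
have hl : l ^+ 2 * quat_nrd u * quat_nrd (w + c *: u) = c.
  rewrite -/p0 /l exprVn !exprMn ee /t; field.
  by rewrite Nu c0 Np0 two0.
have ep := quat_pure_conj su sw ew hl c0.
eexists; last exact: ep.
apply: contraTneq nu0 => p00; move: ep; rewrite p00 !mul0r => w0.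
by rewrite -nw0 -w0 /quat_nrd /= !(expr0n, mulr0, subr0, addr0) vred0 eqxx.
Qed.

End ValuedQuaternion.

(** * Lifting isometries of diagonal skew-hermitian forms *)

Lemma skewE (F : fieldType) (a b : F) (u : quat a b) :
  (u \in Sym (tau a b) true) = (quat_conj u == - u).
Proof. by rewrite unfold_in /= expr1 mulN1r. Qed.

Lemma quatx_skew (F : fieldType) (a b : F) :
  quat_conj (quatx a b) = - quatx a b.
Proof. by apply: quatP; rewrite /= oppr0. Qed.

Section Lifting.
Variables (K : fieldType) (v : dvaluation K) (a b : K).
Hypothesis v_complete : vcomplete v.
Hypothesis k_char : 2 \notin [pchar residue_field v].
Hypotheses (ha : a \in vunit v) (hb : b \in vunit v).
Hypothesis D_division : division_algebra (quat a b).

Local Notation D := (quat a b).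
Local Notation Db := (quat (vred v a) (vred v b)).
Local Notation qred := (qred v a b).
Local Notation qge := (@qge K v a b).
Local Notation tauD := (tau a b).
Local Notation tau0 := (tau (vred v a) (vred v b)).
Local Notation mred M := (map_mx qred M).
Local Notation Db_division := (residue_division v_complete k_char ha hb D_division).

Definition mx_integral m n (M : 'M[D]_(m, n)) := forall i j, qge 0 (M i j).

Lemma qred_sum (I : finType) (f : I -> D) : (forall i, qge 0 (f i)) ->
  qge 0 (\sum_i f i) /\ qred (\sum_i f i) = \sum_i qred (f i).
Proof.
move=> hf; elim/big_rec2: _ => [|i y1 y2 _ [h1 h2]].
  by rewrite qred0; split; first exact: qge0.
by rewrite qredD // h2; split=> //; exact: qgeD.
Qed.

Lemma mx_integralM m n p (M : 'M[D]_(m, n)) (N : 'M_(n, p)) :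
  mx_integral M -> mx_integral N ->
  mx_integral (M *m N) /\ mred (M *m N) = mred M *m mred N.
Proof.
move=> hM hN; have h i j k : qge 0 (M i k * N k j) by apply: qgeM.
split=> [i j|]; first by rewrite mxE; have [] := qred_sum (h i j).
apply/matrixP=> i j; rewrite !mxE.
have [_ ->] := qred_sum (h i j); apply: eq_bigr => k _.
by rewrite !mxE qredM.
Qed.

Lemma mx_integral_ctr m n (M : 'M[D]_(m, n)) : mx_integral M ->
  mx_integral (ctr tauD M) /\ mred (ctr tauD M) = ctr tau0 (mred M).
Proof.
move=> hM; split=> [i j|]; first by rewrite !mxE qge_conj.
by apply/matrixP=> i j; rewrite !mxE qred_conj.
Qed.

Lemma mx_integralB m n (M N : 'M[D]_(m, n)) :
  mx_integral M -> mx_integral N ->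
  mx_integral (M - N) /\ mred (M - N) = mred M - mred N.
Proof.
move=> hM hN; split=> [i j|].
  by rewrite !mxE; apply: qgeD => //; rewrite qgeN.
by apply/matrixP=> i j; rewrite !mxE qredD ?qgeN // qredN.
Qed.

Lemma mred0 m n : mred (0 : 'M[D]_(m, n)) = 0.
Proof. by apply/matrixP=> i j; rewrite !mxE qred0. Qed.

Lemma qge_inv u : qge 0 u -> qred u != 0 ->
  u \is a GRing.unit /\ qge 0 u^-1.
Proof.
move=> hu u0; have uu : u != 0 by apply: contra u0 => /eqP ->; rewrite qred0.
split; first exact: D_division.
have [_ ->] := quat_nrd_unit (quat_div_nrd D_division uu).
have [||hV _] := @vredV _ v (quat_nrd u).
- exact: nrd_vring.
- by rewrite qred_nrd //; exact: quat_div_nrd Db_division u0.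
have : qge 0 (quat_conj u) by rewrite qge_conj.
by move=> /qgeP[? ? ? ?]; apply/qgeP; split; rewrite -vringE /= rpredM.
Qed.

Definition skew_unit u := [/\ qge 0 u, qred u != 0 & quat_conj u = - u].

(** Modulo m_D the off-diagonal blocks of M vanish, so the Schur complement of the
    first entry has the same reduction as the remaining block. Hence elimination
    reduces the statement to lines, where skew_lift applies. *)
Lemma skew_mx_lift n (r : 'rV[D]_n) (M : 'M[D]_n) :
  (forall i, skew_unit (r 0 i)) -> mx_integral M ->
  ctr tauD M = (-1) ^+ true *: M -> mred M = mred (diag_mx r) ->
  mxcong tauD M (diag_mx r).
Proof.
elim: n r M => [|n IH] r M hr hM sM eM.
  exists 1%:M; split; first exact: mx_invertible1.
  by apply/matrixP=> -[].
change ('rV[D]_(1 + n)) in r; change ('M[D]_(1 + n)) in M.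
have {}eM : @map_mx _ _ qred (1 + n) (1 + n) M
  = @map_mx _ _ qred (1 + n) (1 + n) (diag_mx r) := eM.
have [hu u0 su] := hr 0; set u := r 0 0 in hu u0 su.
pose m := M 0 0; have hm : qge 0 m := hM 0 0.
have emu : qred m = qred u.
  by have /matrixP/(_ 0 0) := eM; rewrite !mxE eqxx mulr1n.
have m0 : qred m != 0 by rewrite emu.
have [mu hmV] := qge_inv hm m0.
have sm : quat_conj m = - m.
  by have /matrixP/(_ 0 0) := sM; rewrite !mxE /= mulN1r.
have [p p0 ep] := skew_lift v_complete k_char ha hb D_division hu hm su sm
  (esym emu) u0.
have Au : ulsubmx M = m%:M.
  apply/matrixP=> i j; rewrite !ord1 [RHS]mxE mulr1n !mxE.
  by congr (M _ _); apply: val_inj.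
have e1 : m%:M *m m^-1%:M = 1%:M :> 'M_1 by rewrite -scalar_mxM mulrV.
have e2 : m^-1%:M *m m%:M = 1%:M :> 'M_1 by rewrite -scalar_mxM mulVr.
have Mb : M = block_mx m%:M (ursubmx M) (dlsubmx M) (drsubmx M).
  by rewrite -Au submxK.
have sMb := sM; rewrite Mb in sMb.
have := mxcong_schur e1 e2 sMb; rewrite -Mb; set S := _ - _ => SM.
have rb : diag_mx r = block_mx u%:M 0 0 (diag_mx (rsubmx r)).
  rewrite -[r in LHS]hsubmxK diag_mx_row; congr (block_mx _ _ _ _).
  apply/matrixP=> i j; rewrite !ord1 !mxE /=; congr (r _ _ *+ _).
  exact: val_inj.
have hB : mx_integral (ursubmx M) by move=> i j; rewrite !mxE.
have hC : mx_integral (dlsubmx M) by move=> i j; rewrite !mxE.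
have hV : mx_integral (m^-1%:M : 'M_1) by move=> i j; rewrite !ord1 mxE mulr1n.
have [hCV _] := mx_integralM hC hV; have [hX eX] := mx_integralM hCV hB.
have eB : mred (ursubmx M) = 0.
  by rewrite map_ursubmx eM rb map_block_mx block_mxKur mred0.
rewrite eB mulmx0 in eX.
have hD : mx_integral (drsubmx M) by move=> i j; rewrite !mxE.
have [hS eS] := mx_integralB hD hX.
rewrite eX subr0 map_drsubmx eM rb map_block_mx block_mxKdr in eS.
have sS : ctr tauD S = (-1) ^+ true *: S.
  have := mxcong_sign SM sM; rewrite ctr_block scale_block_mx.
  by move=> /eq_block_mx[_ _ _ ->].
have SR : mxcong tauD S (diag_mx (rsubmx r)).
  by apply: (IH (rsubmx r) S _ hS sS eS) => i; rewrite mxE; exact: hr.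
have mu1 : mxcong tauD (m%:M : 'M_1) (u%:M : 'M_1).
  exists p%:M; split.
    by apply: mx_invertible_scalar; exact: D_division.
  by rewrite ctr_scalar -!scalar_mxM; congr (_%:M).
have := mxcong_trans (mxcong_sym SM) (mxcong_block mu1 SR).
by rewrite -rb.
Qed.

Lemma mx_invertible_lr m n p q (P : 'M[D]_(m, n)) (X : 'M_(p, m)) (Y : 'M_(n, q)) :
  mx_invertible (X *m P) -> mx_invertible (P *m Y) -> mx_invertible P.
Proof.
move=> [L [_ e1]] [R [e2 _]]; exists (Y *m R).
have e3 : P *m (Y *m R) = 1%:M by rewrite mulmxA.
split=> //; have e4 : L *m X *m P = 1%:M by rewrite -mulmxA.
by rewrite -[Y *m R]mul1mx -e4 -(mulmxA _ P) e3 mulmx1.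
Qed.

Lemma mred_lift m n (M : 'M[Db]_(m, n)) :
  exists2 P : 'M[D]_(m, n), mx_integral P & mred P = M.
Proof.
have h e : exists d, qge 0 d && (qred d == e).
  by have [d hd <-] := qred_surj e; exists d; rewrite hd eqxx.
exists (\matrix_(i, j) xchoose (h (M i j))) => [i j|].
  by rewrite mxE; have /andP[] := xchooseP (h (M i j)).
by apply/matrixP=> i j; rewrite !mxE; have /andP[_ /eqP] := xchooseP (h (M i j)).
Qed.

Lemma diag_mx_inv n (r : 'rV[D]_n) : (forall i, skew_unit (r 0 i)) ->
  diag_mx r *m diag_mx (map_mx (fun x => x^-1) r) = 1%:M
  /\ diag_mx (map_mx (fun x => x^-1) r) *m diag_mx r = 1%:M.
Proof.
move=> hr; split; apply/matrixP=> i j; rewrite mulmx_diag !mxE;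
  have [h0 h1 _] := hr i; have [ru _] := qge_inv h0 h1.
  by rewrite (mulrV ru).
by rewrite (mulVr ru).
Qed.

Lemma skew_diag_ctr n (r : 'rV[D]_n) : (forall i, skew_unit (r 0 i)) ->
  ctr tauD (diag_mx r) = (-1) ^+ true *: diag_mx r.
Proof.
move=> hr; apply/matrixP=> i j; rewrite !mxE eq_sym.
have [->|_] := eqVneq i j; last by rewrite !mulr0n inv0 mulr0.
by have [_ _ sr] := hr j; rewrite !mulr1n /= sr mulN1r.
Qed.

Lemma skew_unitV u : skew_unit u -> skew_unit u^-1.
Proof.
move=> [hu u0 su]; have [uu hV] := qge_inv hu u0; split; first exact: hV.
  apply: contraTneq (oner_neq0 Db) => e.
  by rewrite -qred1 -(mulVr uu) (qredM ha hb hV hu) e mul0r eqxx.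
have uN : (quat_conj u) \is a GRing.unit by rewrite su unitrN.
apply: (mulrI uN); rewrite -quat_conjM (mulVr uu) su mulrNN (mulrV uu).
exact: (inv1 tauD).
Qed.

(** Lift an isometry of the reductions entry by entry to a matrix P. It transforms
    diag t into a matrix with the same reduction as diag r, so skew_mx_lift
    makes the two congruent. The same argument for the adjoint of P and the inverse
    diagonals gives P a left inverse as well as a right one. *)
Lemma skew_diag_lift m n (r : 'rV[D]_m) (t : 'rV[D]_n) :
  (forall i, skew_unit (r 0 i)) -> (forall i, skew_unit (t 0 i)) ->
  mxcong tau0 (mred (diag_mx r)) (mred (diag_mx t)) ->
  mxcong tauD (diag_mx r) (diag_mx t).
Proof.
move=> hr ht [Pb [[Pb' [_ Pb'P]] ePb]].
have [P hP eP] := mred_lift Pb.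
have int_diag k (w : 'rV[D]_k) : (forall i, skew_unit (w 0 i)) ->
    mx_integral (diag_mx w).
  move=> hw i j; rewrite mxE; case: eqP => _; last exact: qge0.
  by rewrite mulr1n; case: (hw i).
pose inv k (w : 'rV[D]_k) := map_mx (fun x => x^-1) w.
have hinv k (w : 'rV[D]_k) : (forall i, skew_unit (w 0 i)) ->
    forall i, skew_unit (inv k w 0 i).
  by move=> hw i; rewrite mxE; apply: skew_unitV.
have [rr1 rr2] := diag_mx_inv hr; have [tt1 tt2] := diag_mx_inv ht.
rewrite -/(inv m r) in rr1 rr2; rewrite -/(inv n t) in tt1 tt2.
have [hPc ePc] := mx_integral_ctr hP.
have [hPt ePt] := mx_integralM hP (int_diag n t ht).
have [hM eM] := mx_integralM hPt hPc.
have C1 : mxcong tauD (P *m diag_mx t *m ctr tauD P) (diag_mx r).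
  apply: skew_mx_lift => //; last by rewrite eM ePt ePc eP ePb.
  by rewrite !ctrM ctrK (skew_diag_ctr ht) -scalemxAl sign_mulmx mulmxA.
have [hPr ePr] := mx_integralM hPc (int_diag m _ (hinv m r hr)).
have [hN eN] := mx_integralM hPr hP.
have C2 : mxcong tauD (ctr tauD P *m diag_mx (inv m r) *m P) (diag_mx (inv n t)).
  apply: skew_mx_lift => //; first exact: hinv.
    rewrite !ctrM ctrK (skew_diag_ctr (hinv m r hr)) -scalemxAl sign_mulmx.
    by rewrite mulmxA.
  have mred1 k : mred (1%:M : 'M[D]_k) = 1%:M.
    apply/matrixP=> i j; rewrite !mxE.
    by case: (i == j); rewrite ?mulr1n ?mulr0n ?qred1 ?qred0.
  have [_ et] := mx_integralM (int_diag n t ht) (int_diag n _ (hinv n t ht)).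
  have [_ et'] := mx_integralM (int_diag n _ (hinv n t ht)) (int_diag n t ht).
  have [_ er] := mx_integralM (int_diag m r hr) (int_diag m _ (hinv m r hr)).
  rewrite tt1 mred1 in et; rewrite tt2 mred1 in et'; rewrite rr1 mred1 in er.
  rewrite eN ePr ePc eP -[LHS]mul1mx et' -mulmxA -[RHS]mulmx1; congr (_ *m _).
  have e0 : mred (diag_mx t) *m ctr tau0 Pb = Pb' *m mred (diag_mx r).
    by rewrite -ePb !mulmxA Pb'P mul1mx.
  by rewrite !mulmxA e0 -(mulmxA Pb') -er mulmx1.
have ri : mx_invertible (diag_mx r) by exists (diag_mx (inv m r)).
have ti : mx_invertible (diag_mx (inv n t)) by exists (diag_mx t).
apply: mxcong_trans (mxcong_sym C1) _; exists P; split=> //.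
apply: (@mx_invertible_lr _ _ _ _ _ _ (diag_mx t *m ctr tauD P)
  (mxcong_invertible C2 ti)).
by rewrite mulmxA; exact: mxcong_invertible C1 ri.
Qed.

End Lifting.

(** * The lifting homomorphism of Witt groups *)

Lemma diag_eq (E : unitRingType) (sigma : involution E) s us vs
    (hu : all (symunit sigma s) us) (hv : all (symunit sigma s) vs) :
  us = vs -> iso_cls (diag_form hu) = iso_cls (diag_form hv).
Proof.
by move=> e; subst vs; congr (iso_cls (diag_form _)); apply: bool_irrelevance.
Qed.

Lemma quat_two_unit (F : fieldType) (a b : F) :
  division_algebra (quat a b) -> (2%:R : F) != 0 -> (2%:R : quat a b) \is a GRing.unit.
Proof.
move=> Qdiv two; apply: Qdiv; apply: contra two.
by rewrite !mulr2n => /eqP/(congr1 (@q1 _ _ _)) /= ->.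
Qed.

Lemma quatx_symunit (F : fieldType) (a b : F) :
  a != 0 -> symunit (tau a b) true (quatx a b).
Proof.
move=> a0; apply/andP; split; first by rewrite skewE quatx_skew.
by have /andP[] := quatx_twistable b a0.
Qed.

Section WittLift.
Variables (K : fieldType) (v : dvaluation K) (a b : K).
Hypothesis v_complete : vcomplete v.
Hypothesis k_char : 2 \notin [pchar residue_field v].
Hypotheses (ha : a \in vunit v) (hb : b \in vunit v).
Hypothesis D_division : division_algebra (quat a b).

Local Notation D := (quat a b).
Local Notation Db := (quat (vred v a) (vred v b)).
Local Notation qred := (qred v a b).
Local Notation qge := (@qge K v a b).
Local Notation tauD := (tau a b).
Local Notation tau0 := (tau (vred v a) (vred v b)).
Local Notation nu := (nuD v a b).
Local Notation mred M := (map_mx qred M).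
Local Notation Db_division := (residue_division v_complete k_char ha hb D_division).
Local Notation skew_unit := (@skew_unit K v a b).
Local Notation x := (quatx a b).
Local Notation xb := (quatx (vred v a) (vred v b)).

Lemma two_neq0 : (2%:R : K) != 0.
Proof. by have [] := vred_neq0 (two_vring v) (vred2 k_char). Qed.

Lemma residue_two_neq0 : (2%:R : residue_field v) != 0.
Proof.
have := vred2 k_char.
by rewrite mulr2n vredD ?rpred1 // vred1 -mulr2n.
Qed.

Lemma D_two_unit : (2%:R : D) \is a GRing.unit.
Proof. exact: quat_two_unit D_division two_neq0. Qed.

Lemma Db_two_unit : (2%:R : Db) \is a GRing.unit.
Proof. exact: quat_two_unit Db_division residue_two_neq0. Qed.

Lemma x_symunit : symunit tauD true x.
Proof. exact: quatx_symunit (vunit_neq0 ha). Qed.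

Lemma xb_symunit : symunit tau0 true xb.
Proof. exact: quatx_symunit (vred_unit_neq0 ha). Qed.

Lemma qred_x : qred x = xb.
Proof. by apply: quatP; rewrite /= vred0 vred1. Qed.

Lemma qge_x : qge 0 x.
Proof. by apply/qgeP; rewrite /= !vge0 -vringE rpred1. Qed.

Lemma quatx_neq0 (F : fieldType) (c d : F) : quatx c d != 0.
Proof.
by apply/eqP => /(congr1 (@qx _ _ _)) /= /eqP; rewrite oner_eq0.
Qed.

Lemma skew_unit_x : skew_unit x.
Proof.
by split; rewrite ?qge_x ?quatx_skew // qred_x quatx_neq0.
Qed.

Lemma skew_unitN u : skew_unit u -> skew_unit (- u).
Proof.
move=> [hu u0 su]; split; first by rewrite qgeN.
  by rewrite (qredN hu) oppr_eq0.
by rewrite -[X in _ = - X]su; exact: (invN tauD).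
Qed.

Lemma skew_unit_neq0 u : skew_unit u -> u != 0.
Proof. by move=> [_ u0 _]; apply: contra u0 => /eqP ->; rewrite qred0. Qed.

Lemma skew_unit_sym u : skew_unit u ->
  symunit tauD true u /\ symunit tau0 true (qred u).
Proof.
move=> hu; have u0 := skew_unit_neq0 hu; case: hu => hu ub su; split.
  by apply/andP; split; [rewrite skewE su | exact: D_division].
apply/andP; split; last exact: Db_division.
by rewrite skewE -(qred_conj hu) su (qredN hu).
Qed.

Lemma skew_unit_all us : (forall u, u \in us -> skew_unit u) ->
  all (symunit tauD true) us /\ all (symunit tau0 true) (map qred us).
Proof.
move=> h; split; apply/allP=> u; first by move=> /h /skew_unit_sym[].
by case/mapP=> w /h /skew_unit_sym[_ ? ->].
Qed.

Local Notation dmx us := (diag_mx (\row_i us`_i)).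

Lemma mred_dmx (us : seq D) :
  mxcong tau0 (map_mx qred (dmx us : 'M_(size us)))
    (dmx (map qred us) : 'M_(size (map qred us))).
Proof.
elim: us => [|u us IH].
  by exists 1%:M; split; [exact: mx_invertible1 | apply/matrixP=> -[]].
have e1 := diag_mx_cons u us; have e2 := diag_mx_cons (qred u) (map qred us).
have -> : @map_mx _ _ qred (size (u :: us)) (size (u :: us)) (dmx (u :: us))
    = block_mx ((qred u)%:M : 'M_1) 0 0 (map_mx qred (dmx us : 'M_(size us))).
  transitivity (@map_mx _ _ qred (1 + size us) (1 + size us) (dmx (u :: us))) => //.
  have eu : map_mx qred (u%:M : 'M_1) = (qred u)%:M.
    by apply/matrixP=> i j; rewrite !ord1 !mxE.
  by rewrite e1 map_block_mx !mred0 eu.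
have e3 : mxcong tau0 ((qred u)%:M : 'M_1) ((qred u)%:M : 'M_1).
  by exists 1%:M; split; [exact: mx_invertible1 | rewrite ctr1 mul1mx mulmx1].
by have := mxcong_block e3 IH; rewrite -e2.
Qed.

(** The form g over D has an integral diagonalization with unit entries whose
    reduction is a diagonalization of h. *)
Definition lifts (g : form tauD true) (h : form tau0 true) : Prop :=
  exists us (hu : all (symunit tauD true) us)
    (hu' : all (symunit tau0 true) (map qred us)),
  [/\ forall u, u \in us -> skew_unit u, iso_cls g = iso_cls (diag_form hu)
    & iso_cls h = iso_cls (diag_form hu')].

Lemma lifts_iso g g' h h' : lifts g h -> lifts g' h' ->
  iso_cls h = iso_cls h' -> iso_cls g = iso_cls g'.
Proof.
move=> [us [hu [hu' [su -> ->]]]] [vs [hv [hv' [sv -> ->]]]].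
move=> /eqP/iso_clsP uv; apply: iso_cls_eq.
have row_skew (ws : seq D) : (forall w, w \in ws -> skew_unit w) ->
    forall i : 'I_(size ws), skew_unit ((\row_i ws`_i) 0 i).
  by move=> sw i; rewrite mxE; apply/sw/mem_nth.
apply: (skew_diag_lift v_complete k_char ha hb D_division) (row_skew _ su)
  (row_skew _ sv) _.
apply: mxcong_trans (mred_dmx us) _.
exact: mxcong_trans uv (mxcong_sym (mred_dmx vs)).
Qed.

Lemma lifts_orth g g' h h' : lifts g h -> lifts g' h' ->
  lifts (orth g g') (orth h h').
Proof.
move=> [us [hu [hu' [su eg eh]]]] [vs [hv [hv' [sv eg' eh']]]].
have suv : forall w, w \in us ++ vs -> skew_unit w.
  by move=> w; rewrite mem_cat => /orP[/su|/sv].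
have [huv huv'] := skew_unit_all suv; exists (us ++ vs), huv, huv'; split=> //.
  by rewrite iso_clsD eg eg' (diag_cat huv hu hv).
have hm : all (symunit tau0 true) (map qred us ++ map qred vs) by rewrite -map_cat.
by rewrite iso_clsD eh eh' (diag_eq huv' hm (map_cat _ _ _)) (diag_cat hm hu' hv').
Qed.

Lemma lifts_hplane : lifts (hplane tauD true) (hplane tau0 true).
Proof.
have sx := skew_unit_x; have sN := skew_unitN sx.
have s2 : forall u, u \in [:: x; - x] -> skew_unit u.
  by move=> u; rewrite !inE => /orP[] /eqP ->.
have [hu hu'] := skew_unit_all s2; exists [:: x; - x], hu, hu'; split=> //.
  have [h1 h2] : all (symunit tauD true) [:: x] /\ all (symunit tauD true) [:: - x].
    by move: hu => /= /and3P[-> ->].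
  by rewrite (diag_cons hu h1 h2) (hplane_split D_two_unit).
have e : map qred [:: x; - x] = [:: xb; - xb].
  by rewrite /= qredN ?qge_x // qred_x.
have hb2 : all (symunit tau0 true) [:: xb; - xb] by rewrite -e.
have [h1 h2] : all (symunit tau0 true) [:: xb] /\ all (symunit tau0 true) [:: - xb].
  by move: hb2 => /= /and3P[-> ->].
rewrite (diag_eq hu' hb2 e).
by rewrite (diag_cons hb2 h1 h2) (hplane_split Db_two_unit).
Qed.

Lemma skew_unit_surj (e : Db) : symunit tau0 true e ->
  exists2 u, skew_unit u & qred u = e.
Proof.
case/andP; rewrite skewE (quat_pureP _ residue_two_neq0) => /eqP e1 eu.
have [d hd ed] := qred_surj e; pose u := Quat a b 0 (qx d) (qy d) (qz d).
have d1 : vred v (q1 d) = 0 by rewrite -[RHS]e1 -ed.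
have eE : qred u = e by rewrite -ed; apply: quatP; rewrite /= vred0 d1.
exists u => //; split.
- by case/qgeP: hd => *; apply/qgeP; rewrite /= vge0.
- by rewrite eE; apply: contraTneq eu => ->; rewrite unitr0.
- by apply: quatP; rewrite /= oppr0.
Qed.

Lemma lifts_exist h : exists g, lifts g h.
Proof.
have [es [he eh]] := diagonalize Db_division xb_symunit Db_two_unit h.
have [us su eus] : exists2 us, (forall u, u \in us -> skew_unit u) & map qred us = es.
  elim: es he {eh} => [|e es IH] /=; first by exists [::].
  case/andP=> /skew_unit_surj[u su <-] /IH[us sus <-]; exists (u :: us) => // w.
  by rewrite inE => /orP[/eqP ->|/sus].
have [hu hu'] := skew_unit_all su; exists (diag_form hu), us, hu, hu'.
by split=> //; rewrite eh; apply: diag_eq.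
Qed.

(** Taking lifts is the homomorphism from the residual Witt group to W(D), a
    section of the first residue map. *)
Lemma witt_lift : exists L : {additive witt tau0 true -> witt tauD true},
  forall g h, lifts g h -> L (witt_cls h) = witt_cls g.
Proof.
have [G hG] := choice lifts_exist.
have [g h e|g h||L hL] := @witt_universal _ tau0 true _ (fun h => witt_cls (G h)).
- exact/witt_cls_eq/(lifts_iso (hG g) (hG h)).
- rewrite -(witt_clsD (iso_clsD _ _)); apply: witt_cls_eq.
  by apply: lifts_iso (hG _) (lifts_orth (hG g) (hG h)) _.
- rewrite -(witt_hplane tauD true); apply: witt_cls_eq.
  by apply: lifts_iso (hG _) lifts_hplane _.
exists L => g h gh; rewrite hL; apply: witt_cls_eq.
by apply: lifts_iso (hG h) gh _.
Qed.

Lemma conj_scalar (c : K) : quat_conj (c%:A : D) = c%:A.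
Proof. by apply: quatP; split; rewrite /= ?mulr0 ?oppr0. Qed.

(** Scale p to an integral vector with nonzero reduction. The value there is a unit,
    as the residue form is anisotropic, and the scaling changes its valuation by an
    even number. *)
Lemma diag_value_even (us : seq D) (hu' : all (symunit tau0 true) (map qred us))
    (p : 'rV[D]_(size us)) :
  (forall u, u \in us -> skew_unit u) -> anisotropic (diag_form hu') -> p != 0 ->
  exists N, [/\ p *m dmx us *m ctr tauD p = N%:M, N != 0
    & exists k : int, nu N = (k + k)%:~R].
Proof.
move=> su ah p0.
have [c c0 [hc [j hj]]] := row_scale v p0.
pose N := (p *m dmx us *m ctr tauD p) 0 0.
have eN : p *m dmx us *m ctr tauD p = N%:M.
  by apply/matrixP=> i i'; rewrite !ord1 [RHS]mxE mulr1n.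
pose P : 'rV[D]_(size us) := (c%:A)%:M *m p.
have Pij i : P 0 i = c *: p 0 i by rewrite /P mul_scalar_mx mxE mulr_algl.
have eP : P *m dmx us *m ctr tauD P = (c ^+ 2 *: N)%:M.
  rewrite ctrM ctr_scalar /= conj_scalar !mulmxA -!(mulmxA (c%:A)%:M) eN -!scalar_mxM.
  by rewrite mulr_algl -scalerAr mulr1 scalerA expr2.
have hP : mx_integral v P by move=> i k; rewrite ord1 Pij.
have hd : mx_integral v (dmx us : 'M_(size us)).
  move=> i k; rewrite !mxE; case: eqP => _; last exact: qge0.
  by rewrite mulr1n; case: (su us`_i); rewrite ?mem_nth.
have [hPc ePc] := mx_integral_ctr hP.
have [h1 e1] := mx_integralM ha hb hP hd.
have [h2 e2] := mx_integralM ha hb h1 hPc.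
rewrite e1 ePc eP in e2; rewrite eP in h2.
have hn : qge 0 (c ^+ 2 *: N) by have := h2 0 0; rewrite mxE mulr1n.
have mP0 : mred P != 0.
  apply: contra hj => /eqP/matrixP/(_ 0 j); rewrite [in X in X -> _]mxE Pij => ->.
  by rewrite mxE.
have n0 : qred (c ^+ 2 *: N) != 0.
  apply/eqP => n0.
  have ez : mred P *m mred (dmx us) *m ctr tau0 (mred P) = 0.
    rewrite -e2; apply/matrixP=> i k; rewrite !ord1 !mxE mulr1n.
    exact: n0.
  have [q eq q0] := mxcong_row (mxcong_sym (mred_dmx us)) ez mP0.
  by move: q0; rewrite (ah q eq) eqxx.
have N0 : N != 0 by apply: contra n0 => /eqP ->; rewrite scaler0 qred0.
exists N; split=> //; exists (- v c).
have := nuD_unit v_complete k_char ha hb D_division hn n0.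
rewrite nuDZ ?expf_neq0 // expr2 dvalM // => /eqP.
by rewrite addrC addr_eq0 -opprD rmorphN => /eqP.
Qed.

Variable pi : K.
Hypothesis hpi : pi \in vuniformizer v.

Lemma pi_neq0 : pi != 0. Proof. by case/andP: hpi. Qed.
Lemma v_pi : v pi = 1. Proof. by case/andP: hpi => _ /eqP. Qed.

Lemma scalar_unit (c : K) : c != 0 -> (c%:A : D) \is a GRing.unit.
Proof.
by move=> c0; apply: D_division; rewrite scaler_eq0 negb_or c0 oner_neq0.
Qed.

Lemma scalar_tauE (c : K) : c != 0 -> forall e, tauD e = c%:A * tauD e * (c%:A)^-1.
Proof.
move=> c0 e; apply: (mulIr (scalar_unit c0)); rewrite mulrVK ?scalar_unit //.
by rewrite mulr_algl mulr_algr.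
Qed.

Lemma scalar_tau_sign (c : K) :
  tauD (c%:A) = (-1) ^+ true * (-1) ^+ true * c%:A.
Proof. by rewrite /= conj_scalar mulrNN !mul1r. Qed.

Lemma odd_neq_even (k l : int) : 1 + (l + l) <> k + k.
Proof. lia. Qed.

Definition pi_form : form tauD true -> form tauD true :=
  scale_form (scalar_unit pi_neq0) (scalar_tauE pi_neq0) (scalar_tau_sign pi).

(** Nonzero values of g0 have even valuation and nonzero values of pi g1 have odd
    valuation, so they cannot cancel. *)
Lemma anisotropic_lift g0 g1 h0 h1 : lifts g0 h0 -> lifts g1 h1 ->
  anisotropic h0 -> anisotropic h1 -> anisotropic (orth g0 (pi_form g1)).
Proof.
move=> [us [hu [hu' [su eg eh]]]] [vs [hv [hv' [sv eg' eh']]]] a0 a1.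
have {}a0 := anisotropic_iso eh a0; have {}a1 := anisotropic_iso eh' a1.
apply: (@anisotropic_iso _ _ _ (orth (diag_form hu) (pi_form (diag_form hv)))).
  by rewrite !iso_clsD eg; congr (_ + _); apply/scale_form_iso/esym.
move=> p; rewrite -[p]hsubmxK /=; move: (lsubmx p) (rsubmx p) => p0 p1 {p}.
rewrite ctr_row mul_row_block !(mulmx0, add0r, addr0) mul_row_col.
have piC : (pi%:A)%:M *m ctr tauD p1 = ctr tauD p1 *m (pi%:A)%:M.
  by rewrite -(ctr_scale (scalar_unit pi_neq0) (scalar_tauE pi_neq0)).
rewrite -!mulmxA piC !mulmxA => e.
have [p00|p00] := eqVneq p0 0; have [p10|p10] := eqVneq p1 0.
- by rewrite p00 p10 row_mx0.
- have [N [eN N0 _]] := diag_value_even sv a1 p10.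
  move: e; rewrite p00 !mul0mx add0r eN -scalar_mxM => /matrixP/(_ 0 0).
  rewrite !mxE mulr1n => /eqP; rewrite mulr_algr scaler_eq0 (negPf pi_neq0).
  by rewrite (negPf N0).
- have [N [eN N0 _]] := diag_value_even su a0 p00.
  move: e; rewrite p10 !mul0mx addr0 eN => /matrixP/(_ 0 0).
  by rewrite !mxE mulr1n => /eqP; rewrite (negPf N0).
have [N [eN N0 [k ek]]] := diag_value_even su a0 p00.
have [M [eM M0 [l el]]] := diag_value_even sv a1 p10.
move: e; rewrite eN eM -scalar_mxM -raddfD /= => /matrixP/(_ 0 0).
rewrite !mxE mulr1n mulr_algr => /eqP; rewrite addr_eq0 -scaleNr => /eqP e.
have := ek; rewrite e nuDZ ?oppr_eq0 ?pi_neq0 // dvalN v_pi el -rmorphD /=.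
by move/eqP; rewrite eqr_int => /eqP/odd_neq_even.
Qed.

End WittLift.

(** * The residue isomorphism *)

Lemma quatx_inv (F : fieldType) (a b : F) (a0 : a != 0) :
  (quatx a b)^-1 = a^-1 *: quatx a b.
Proof.
have /andP[xu _] := quatx_twistable b a0.
apply: (mulrI xu); rewrite mulrV //.
by apply: quatP; split=> /=; field.
Qed.

Section Twisted.
Variables (E : unitRingType) (sigma : involution E) (c : E).
Hypothesis Hc : twistable sigma c.
Hypothesis c_skew : sigma c = - c.

Lemma inv_V d : d \is a GRing.unit -> sigma d^-1 = (sigma d)^-1.
Proof.
move=> du; apply: (mulrI (inv_unit sigma du)).
by rewrite -invM mulVr // inv1 mulrV // inv_unit.
Qed.

Lemma twist_inv e : sigma e = c^-1 * twist Hc e * c^-1^-1.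
Proof.
have cu : c \is a GRing.unit by case/andP: Hc.
by rewrite /= /twist_fun invrK !mulrA mulVr // mul1r mulrVK.
Qed.

Lemma twist_inv_sign : twist Hc c^-1 = (-1) ^+ false * (-1) ^+ true * c^-1.
Proof.
have cu : c \is a GRing.unit by case/andP: Hc.
rewrite /= /twist_fun inv_V // c_skew invrN mulrN mulrV // mulN1r expr0 expr1.
by rewrite mul1r mulN1r.
Qed.

Lemma skew_sign : sigma c = (-1) ^+ true * (-1) ^+ false * c.
Proof. by rewrite c_skew expr1 expr0 mulr1 mulN1r. Qed.

End Twisted.

Section LarmourIso.
Variables (K : fieldType) (v : dvaluation K) (a b : K).
Hypothesis v_complete : vcomplete v.
Hypothesis k_char : 2 \notin [pchar residue_field v].
Hypotheses (ha : a \in vunit v) (hb : b \in vunit v).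
Hypothesis D_division : division_algebra (quat a b).
Variable pi : K.
Hypothesis hpi : pi \in vuniformizer v.

Local Notation D := (quat a b).
Local Notation qred := (qred v a b).
Local Notation qge := (@qge K v a b).
Local Notation tauD := (tau a b).
Local Notation tau0 := (tau (vred v a) (vred v b)).
Local Notation tau1 := (tau_x (vred v b) (vred_unit_neq0 ha)).
Local Notation nu := (nuD v a b).
Local Notation skew_unit := (@skew_unit K v a b).
Local Notation x := (quatx a b).
Local Notation xb := (quatx (vred v a) (vred v b)).
Local Notation p := (pi *: x).

Let pi0 : pi != 0 := pi_neq0 hpi.

Let xu : x \is a GRing.unit.
Proof. by have /andP[] := quatx_twistable b (vunit_neq0 ha). Qed.

Let xbu : xb \is a GRing.unit.
Proof. by have /andP[] := quatx_twistable (vred v b) (vred_unit_neq0 ha). Qed.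

Let xbV_unit : xb^-1 \is a GRing.unit.
Proof. by rewrite unitrV. Qed.

Lemma tau1E e : tau1 e = xb * tau0 e * xb^-1. Proof. by []. Qed.

Lemma xb_tau_sign : tau0 xb = (-1) ^+ true * (-1) ^+ false * xb.
Proof. by apply: skew_sign; exact: quatx_skew. Qed.

Lemma tau0E e : tau0 e = xb^-1 * tau1 e * xb^-1^-1.
Proof. exact: twist_inv. Qed.

Lemma xbV_tau1_sign : tau1 xb^-1 = (-1) ^+ false * (-1) ^+ true * xb^-1.
Proof. by apply: twist_inv_sign; exact: quatx_skew. Qed.

Let Xform : form tau1 false -> form tau0 true :=
  scale_form xbu tau1E xb_tau_sign.
Let XVform : form tau0 true -> form tau1 false :=
  scale_form xbV_unit tau0E xbV_tau1_sign.

Lemma XformK g : iso_cls (XVform (Xform g)) = iso_cls g.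
Proof.
apply: iso_cls_eq; exists 1%:M; split; first exact: mx_invertible1.
by rewrite ctr1 mul1mx mulmx1 /= -mulmxA -scalar_mxM (mulrV xbu) mulmx1.
Qed.

Lemma qge_xV : qge 0 x^-1.
Proof.
have x0 : qred x != 0 by rewrite qred_x quatx_neq0.
by have [] := qge_inv v_complete k_char ha hb D_division (qge_x v a b) x0.
Qed.

Lemma qred_xV : qred x^-1 = xb^-1.
Proof.
apply: (mulIr xbu); rewrite (mulVr xbu) -qred_x.
by rewrite -(qredM ha hb qge_xV (qge_x _ _ _)) (mulVr xu) qred1.
Qed.

Lemma pV : p^-1 = pi^-1 *: x^-1.
Proof. by rewrite invrZ // unitfE. Qed.

Lemma nu_p : nu p = 1.
Proof.
have [hx x0 _] := skew_unit_x v a b.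
rewrite nuDZ ?quatx_neq0 ?(v_pi hpi) //.
by rewrite (nuD_unit v_complete k_char ha hb D_division hx x0) addr0.
Qed.

Lemma unram_skew_unit u : symunit tauD true u -> nu u = 0 -> skew_unit u.
Proof.
move=> /andP[su uu] nu0; have u0 : u != 0 by apply: contraTneq uu => ->; rewrite unitr0.
have [h1 h2] := nuD0 v_complete k_char ha hb D_division u0 nu0.
by split=> //; apply/eqP; rewrite -skewE.
Qed.

Lemma ram_skew_unit w : symunit tauD true w -> nu w = 1 ->
  skew_unit (pi^-1 *: w).
Proof.
move=> /andP[sw wu] nw; have w0 : w != 0 by apply: contraTneq wu => ->; rewrite unitr0.
have pV0 : pi^-1 != 0 by rewrite invr_eq0.
have pw0 : pi^-1 *: w != 0 by rewrite scaler_eq0 negb_or pV0.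
have [|h1 h2] := nuD0 v_complete k_char ha hb D_division pw0.
  by rewrite nuDZ // nw dvalV // (v_pi hpi) rmorphN /= addNr.
split=> //; rewrite quat_conjZ; move: sw; rewrite skewE => /eqP ->.
by rewrite scalerN.
Qed.

Lemma ram_residue w : symunit tauD true w -> nu w = 1 ->
  qred (w * p^-1) = qred (pi^-1 *: w) * xb^-1.
Proof.
move=> sw nw; have [h1 _ _] := ram_skew_unit sw nw.
by rewrite pV -scalerAr scalerAl (qredM ha hb h1 qge_xV) qred_xV.
Qed.

(** Replacing u by c u c changes its valuation by an even number. *)
Lemma line_unit_or_uniformizer u (hu : all (symunit tauD true) [:: u]) :
  exists w (hw : all (symunit tauD true) [:: w]),
    iso_cls (diag_form hu) = iso_cls (diag_form hw) /\ (nu w = 0 \/ nu w = 1).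
Proof.
have /andP[su uu] : symunit tauD true u by case/andP: (hu).
have u0 : u != 0 by apply: contraTneq uu => ->; rewrite unitr0.
have [m em _] := nuD_int v_complete k_char ha hb D_division u0.
have [c c0 vc] := dval_surj v (- (m %/ 2)%Z).
pose w := c ^+ 2 *: u.
have w0 : w != 0 by rewrite scaler_eq0 negb_or expf_neq0.
have sw : symunit tauD true w.
  apply/andP; split; last exact: D_division.
  move: su; rewrite !skewE quat_conjZ => /eqP ->.
  by rewrite scalerN.
have hw : all (symunit tauD true) [:: w] by rewrite /= sw.
exists w, hw; split.
  apply/esym/iso_cls_eq; exists (c%:A)%:M; split.
    by apply: mx_invertible_scalar; apply: scalar_unit.
  rewrite ctr_scalar /= !diag_mx1 -!scalar_mxM conj_scalar mulr_algl mulr_algr.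
  by rewrite scalerA -expr2.
have -> : nu w = (m %% 2)%Z%:~R.
  rewrite nuDZ ?expf_neq0 // expr2 dvalM // vc em -rmorphD /=; congr (_%:~R).
  by rewrite /modz; ring.
have := modz_ge0 m (isT : 2 != 0 :> int); have := ltz_pmod m (isT : 0 < 2 :> int).
by case: (m %% 2)%Z => [[|[|r]]|r] // _ _; [left | right].
Qed.

Lemma witt_larmour_form (y : witt tauD true) :
  exists us vs (hu : all (symunit tauD true) us) (hv : all (symunit tauD true) vs),
    [/\ {in us, forall u, nu u = 0}, {in vs, forall w, nu w = nu p}
      & y = witt_cls (orth (diag_form hu) (diag_form hv))].
Proof.
elim/(witt_line_ind D_division (D_two_unit k_char D_division) (x_symunit b ha)): y.
  exists [::], [::], isT, isT; split=> //.
  by rewrite witt_cls0 // iso_clsD !diag_nil addr0.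
move=> u hu y [us [vs [hus [hvs [nus nvs ->]]]]].
have [w [hw [-> nw]]] : exists w (hw : all (symunit tauD true) [:: w]),
    witt_cls (diag_form hu) = witt_cls (diag_form hw) /\ (nu w = 0 \/ nu w = 1).
  have [w [hw [e nw]]] := line_unit_or_uniformizer hu.
  by exists w, hw; rewrite (witt_cls_eq e).
have cons_all ws : all (symunit tauD true) ws -> all (symunit tauD true) (w :: ws).
  by move: (hw) => /= /andP[-> _].
case: nw => nw.
  exists (w :: us), vs, (cons_all _ hus), hvs; split=> //.
    by move=> u'; rewrite inE => /orP[/eqP ->|/nus].
  rewrite !(witt_clsD (iso_clsD _ _)) (witt_clsD (diag_cons (cons_all _ hus) hw hus)).
  by rewrite addrA.
exists us, (w :: vs), hus, (cons_all _ hvs); split=> //.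
  by move=> u'; rewrite inE => /orP[/eqP ->|/nvs] //; rewrite nw nu_p.
rewrite !(witt_clsD (iso_clsD _ _)) (witt_clsD (diag_cons (cons_all _ hvs) hw hvs)).
by rewrite addrCA.
Qed.

(** The inverse of Larmour's isomorphism: (alpha, beta) goes to the lift of alpha
    plus pi times the lift of beta x, where multiplication by x turns hermitian
    forms for tau_x into skew-hermitian forms for tau. It is injective because
    anisotropic representatives of alpha and beta x lift to an anisotropic form,
    and surjective because classes of lines have representatives of valuation 0
    or 1. *)
Lemma larmour_inverse : exists lam : witt tau0 true * witt tau1 false -> witt tauD true,
  [/\ {morph lam : u w / u - w}, injective lam,
    (forall y, exists z, lam z = y) &
    forall (us vs : seq D) (hu : all (symunit tauD true) us)
      (hv : all (symunit tauD true) vs),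
    {in us, forall u, nu u = 0} -> {in vs, forall w, nu w = nu p} ->
    exists (hu' : all (symunit tau0 true) [seq qred u | u <- us])
      (hv' : all (symunit tau1 false) [seq qred (w * p^-1) | w <- vs]),
    lam (witt_cls (diag_form hu'), witt_cls (diag_form hv'))
      = witt_cls (orth (diag_form hu) (diag_form hv))].
Proof.
have [L hL] := witt_lift v_complete k_char ha hb D_division.
have [S hS] := witt_scale (scalar_unit D_division pi0)
  (scalar_tauE D_division pi0) (scalar_tau_sign a b pi).
have [X hX] := witt_scale xbu tau1E xb_tau_sign.
have [XV hXV] := witt_scale xbV_unit tau0E xbV_tau1_sign.
pose lam z := L z.1 + S (L (X z.2)).
have XK : cancel X XV.
  elim/groth_ind=> -[c d]; elim/iso_cls_ind: c => g; elim/iso_cls_ind: d => h.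
  rewrite [groth_cls _ _]witt_clsB !raddfB !hX !hXV.
  by rewrite (witt_cls_eq (XformK g)) (witt_cls_eq (XformK h)).
have lamB : {morph lam : u w / u - w}.
  by move=> u w; rewrite /lam /= !raddfB addrACA opprD.
have Db_two := Db_two_unit v_complete k_char ha hb D_division.
have Db_div := residue_division v_complete k_char ha hb D_division.
have diagL us (hu : all (symunit tauD true) us)
    (hu' : all (symunit tau0 true) (map qred us)) :
    (forall u, u \in us -> skew_unit u) ->
    L (witt_cls (diag_form hu')) = witt_cls (diag_form hu).
  by move=> su; apply: hL; exists us, hu, hu'.
have lam_diag (us vs : seq D) (hu : all (symunit tauD true) us)
      (hv : all (symunit tauD true) vs) :
    {in us, forall u, nu u = 0} -> {in vs, forall w, nu w = nu p} ->
    exists (hu' : all (symunit tau0 true) [seq qred u | u <- us])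
      (hv' : all (symunit tau1 false) [seq qred (w * p^-1) | w <- vs]),
    lam (witt_cls (diag_form hu'), witt_cls (diag_form hv'))
      = witt_cls (orth (diag_form hu) (diag_form hv)).
  move=> nus nvs.
  have su : forall u, u \in us -> skew_unit u.
    by move=> u uin; apply: unram_skew_unit (nus u uin); exact: (allP hu).
  have sv : forall w, w \in vs -> symunit tauD true w /\ nu w = 1.
    by move=> w win; rewrite (nvs w win) nu_p; split=> //; exact: (allP hv).
  pose ws := [seq pi^-1 *: w | w <- vs].
  have sw : forall w, w \in ws -> skew_unit w.
    by move=> _ /mapP[w /sv[h1 h2] ->]; apply: ram_skew_unit.
  have [_ hu'] := skew_unit_all v_complete k_char ha hb D_division su.
  have [hw hw'] := skew_unit_all v_complete k_char ha hb D_division sw.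
  have hv' : all (symunit tau1 false) [seq qred (w * p^-1) | w <- vs].
    apply/allP=> _ /mapP[w win ->]; have [h1 h2] := sv w win.
    rewrite ram_residue //; apply: (symunit_scale xbV_unit tau0E xbV_tau1_sign).
    by apply: (allP hw'); apply/mapP; exists (pi^-1 *: w) => //; apply: map_f.
  exists hu', hv'.
  rewrite (witt_clsD (iso_clsD _ _)) /lam /= (diagL us hu hu' su); congr (_ + _).
  have hX' : all (symunit tau0 true) [seq e * xb | e <- [seq qred (w * p^-1) | w <- vs]].
    apply/allP=> _ /mapP[e ein ->].
    by apply: (symunit_scale xbu tau1E xb_tau_sign); exact: (allP hv').
  rewrite hX (witt_cls_eq (scale_form_diag _ _ _ hv' hX')).
  have e1 : [seq e * xb | e <- [seq qred (w * p^-1) | w <- vs]] = map qred ws.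
    rewrite -!map_comp; apply/eq_in_map => w /sv[h1 h2] /=.
    by rewrite ram_residue // (mulrVK xbu).
  rewrite (witt_cls_eq (diag_eq hX' hw' e1)) (diagL ws hw hw' sw) hS.
  have hS' : all (symunit tauD true) [seq w * pi%:A | w <- ws].
    apply/allP=> _ /mapP[e ein ->].
    apply: (symunit_scale (scalar_unit D_division pi0)
      (scalar_tauE D_division pi0) (scalar_tau_sign a b pi)).
    exact: (allP hw).
  rewrite (witt_cls_eq (scale_form_diag _ _ _ hw hS')); apply: witt_cls_eq.
  apply: diag_eq; rewrite -map_comp -[RHS]map_id; apply/eq_in_map => w _ /=.
  by rewrite mulr_algr scalerA mulfV // scale1r.
exists lam; split=> //.
- move=> z z' e; apply/eqP; rewrite -subr_eq0; apply/eqP.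
  have {e} : lam (z - z') = 0 by rewrite lamB e subrr.
  case: (z - z') => al be; rewrite /lam /=.
  have [h0 a0 ->] := witt_anisotropic Db_div Db_two (xb_symunit b ha) al.
  have [h1 a1 eX] := witt_anisotropic Db_div Db_two (xb_symunit b ha) (X be).
  have [g0 l0] := lifts_exist v_complete k_char ha hb D_division h0.
  have [g1 l1] := lifts_exist v_complete k_char ha hb D_division h1.
  rewrite eX (hL _ _ l0) (hL _ _ l1) hS => e0.
  have ao := @anisotropic_lift _ _ _ _ v_complete k_char ha hb D_division _ hpi _ _ _ _ l0 l1 a0 a1.
  have := witt_anisotropic_eq0 D_division (D_two_unit k_char D_division)
    (x_symunit b ha) ao.
  rewrite (witt_clsD (iso_clsD _ _)) => /(_ e0) /form_dim_iso0 /= /eqP.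
  rewrite addn_eq0 => /andP[/eqP d0 /eqP d1].
  have lift0 (g : form tauD true) (h : form tau0 true) :
      lifts g h -> form_dim g = 0%N -> witt_cls h = 0.
    move=> [us [hu [hu' [_ eg eh]]]] /iso_cls_dim0; rewrite eg.
    move=> /form_dim_iso0 /= /size0nil us0; subst us.
    by rewrite (witt_cls_eq eh); apply/witt_cls0/diag_nil.
  rewrite (lift0 _ _ l0 d0); congr (_, _); rewrite -[be]XK eX.
  by rewrite (lift0 _ _ l1 d1) raddf0.
- move=> y; have [us [vs [hu [hv [nus nvs ->]]]]] := witt_larmour_form y.
  have [hu' [hv' e]] := lam_diag us vs hu hv nus nvs.
  by exists (witt_cls (diag_form hu'), witt_cls (diag_form hv')).
Qed.

Lemma larmour_iso :
  exists partial : {additive witt tauD true -> witt tau0 true * witt tau1 false},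
  [/\ is_larmour nu qred p partial, bijective partial &
    forall partial', @is_larmour _ _ nu qred tauD true p tau0 tau1 partial' ->
      partial' =1 partial].
Proof.
have [lam [lamB lam_inj lam_surj lam_diag]] := larmour_inverse.
have [f fK] := choice lam_surj.
have f_zmod : zmod_morphism f by move=> y z; apply: lam_inj; rewrite lamB !fK.
pose fM := GRing.isZmodMorphism.Build _ _ f f_zmod.
pose F : {additive witt tauD true -> witt tau0 true * witt tau1 false} := HB.pack f fM.
have larF : is_larmour nu qred p F.
  move=> us vs hu hv nus nvs; have [hu' [hv' e]] := lam_diag us vs hu hv nus nvs.
  by exists hu', hv'; apply: lam_inj; rewrite fK.
exists F; split.
- exact: larF.
- by exists lam => [y|z]; [exact: fK | apply: lam_inj; rewrite fK].
move=> G larG y; have [us [vs [hu [hv [nus nvs ->]]]]] := witt_larmour_form y.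
have [hu1 [hv1 ->]] := larG us vs hu hv nus nvs.
have [hu2 [hv2 ->]] := larF us vs hu hv nus nvs.
by congr (_, _); apply: witt_cls_eq; apply: diag_eq.
Qed.

End LarmourIso.

(** * Symmetric elements, orthogonality and the theorem *)

Section Span.
Variables (F : fieldType) (V : vectType F).

Lemma mem_span3 (d1 d2 d3 e : V) : reflect
  (exists c : F * F * F, e = c.1.1 *: d1 + c.1.2 *: d2 + c.2 *: d3)
  (e \in <<[:: d1; d2; d3]>>%VS).
Proof.
rewrite !span_cons span_nil addv0; apply: (iffP idP) => [|[c ->]].
  move=> /memv_addP[_ /vlineP[c1 ->]] [_ /memv_addP[_ /vlineP[c2 ->] [_ /vlineP[c3 ->] ->]] ->].
  by exists (c1, c2, c3); rewrite /= addrA.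
by rewrite -addrA !memv_add // rpredZ // memv_line.
Qed.

End Span.

Section QuaternionInvolutions.
Variables (F : fieldType) (a b : F).
Hypothesis two : (2%:R : F) != 0.
Local Notation Q := (quat a b).
Implicit Types e : Q.

Lemma Sym_tau_span :
  Sym (tau a b) true =i <<[:: quatx a b; quaty a b; quatz a b]>>%VS.
Proof.
move=> e; rewrite skewE (quat_pureP e two).
apply/eqP/mem_span3 => [e1|[c ->]]; last by rewrite /= !mulr0 !addr0.
exists (qx e, qy e, qz e); apply: quatP; split=> /=; rewrite ?e1; ring.
Qed.

Hypothesis a0 : a != 0.

Lemma tau_xE e : tau_x b a0 e = Quat a b (q1 e) (- qx e) (qy e) (qz e).
Proof.
have /andP[xu _] := quatx_twistable b a0.
apply: (mulIr xu); rewrite /= /twist_fun mulrVK //.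
by apply: quatP; split=> /=; ring.
Qed.

Lemma tau_x_fix e : (tau_x b a0 e == e) = (qx e == 0).
Proof.
rewrite tau_xE; apply/eqP/eqP => [/(congr1 (@qx F a b))/= /eqP|h].
  by rewrite eq_sym -addr_eq0 -mulr2n -mulr_natl mulf_eq0 (negPf two) => /eqP.
by apply: quatP; split; rewrite //= h oppr0.
Qed.

Lemma mem_span_1yz e :
  (e \in <<[:: 1%R; quaty a b; quatz a b]>>%VS) = (qx e == 0).
Proof.
apply/mem_span3/eqP => [[c ->]|e1]; first by rewrite /= !mulr0 !addr0.
exists (q1 e, qy e, qz e); apply: quatP; split=> /=; rewrite ?e1; ring.
Qed.

Lemma Sym_tau_x_span :
  Sym (tau_x b a0) false =i <<[:: 1%R; quaty a b; quatz a b]>>%VS.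
Proof. by move=> e; rewrite mem_span_1yz unfold_in expr0 mul1r tau_x_fix. Qed.

Lemma tau_x_orthogonal : orthogonal_involution (tau_x b a0).
Proof.
split; first by move=> c e; rewrite !tau_xE; apply: quatP; split; rewrite //= mulrN.
exists 2, <<[:: 1%R; quaty a b; quatz a b]>>%VS; split.
- by rewrite dimvf.
- by move=> e; rewrite mem_span_1yz tau_x_fix.
have fr : free [:: 1%R : Q; quaty a b; quatz a b].
  apply/(@freeP _ _ _ [tuple 1%R : Q; quaty a b; quatz a b]) => k.
  rewrite !big_ord_recl big_ord0 /= addr0 => e.
  have e1 := congr1 (@q1 F a b) e; have e2 := congr1 (@qy F a b) e.
  have e3 := congr1 (@qz F a b) e; move: e1 e2 e3.
  rewrite /= !(mulr0, mulr1, addr0, add0r) => e1 e2 e3.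
  by case=> -[|[|[|//]]] hi; [rewrite -[RHS]e1|rewrite -[RHS]e2|rewrite -[RHS]e3];
    congr (k _); apply: val_inj.
by move: fr; rewrite /free => /eqP ->.
Qed.

End QuaternionInvolutions.

Theorem mainTheorem7 (K : fieldType) (v : dvaluation K) (v_complete : vcomplete v)
    (k_char : 2 \notin [pchar residue_field v])
    (a b : K) (ha : a \in vunit v) (hb : b \in vunit v)
    (D_division : division_algebra (quat a b))
    (pi : K) (hpi : pi \in vuniformizer v) :
  let x := quatx a b in
  let y := quaty a b in
  let z := quatz a b in
  let pi' := pi *: x in
  let bar := qred v a b in
  let tauD := tau a b in
  let taux := tau_x b (vunit_neq0 ha) in
  let tau0 := tau (vred v a) (vred v b) in
  let tau1 := tau_x (vred v b) (vred_unit_neq0 ha) in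
  let nu := nuD v a b in
  [/\ [/\ eps_uniformizer nu tauD true pi',
          twist_fun tauD pi' =1 taux
        & orthogonal_involution taux],
      [/\ is_reduction (OD v a b) (mD v a b) bar,
          division_algebra (quat (vred v a) (vred v b))
        & {in OD v a b, forall d,
             bar (tauD d) = tau0 (bar d)
          /\ bar (twist_fun tauD pi' d) = tau1 (bar d)}],
      [/\ Sym tauD true =i <<[:: x; y; z]>>%VS,
          Sym tau0 true =i <<[:: bar x; bar y; bar z]>>%VS
        & Sym tau1 false =i <<[:: bar 1%R; bar y; bar z]>>%VS]
    & exists partial : {additive witt tauD true -> witt tau0 true * witt tau1 false},
      [/\ is_larmour nu bar pi' partial,
          forall partial', is_larmour nu bar pi' partial' -> partial' =1 partial,
          bijective partial,
          forall alpha beta gamma : K,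
            alpha \in vring v -> beta \in vring v -> gamma \in vring v ->
            let u := alpha *: x + beta *: y + gamma *: z in
            u \in ODunit v a b ->
            exists (hu : all (symunit tauD true) [:: u])
                   (hu' : all (symunit tau0 true) [:: bar u]),
              (partial (witt_cls (diag_form hu))).1 = witt_cls (diag_form hu')
        & forall alpha beta gamma : K,
            alpha \in vmax v -> beta \in vmax v -> gamma \in vmax v ->
            let w := alpha *: x + beta *: y + gamma *: z in
            w != 0 -> nu w = 1 ->
            (* w' = w pi'^-1, as y x^-1 = - a^-1 z and z x^-1 = - y *)
            let w' := pi^-1 *: (alpha%:A - gamma *: y - (a^-1 * beta) *: z) in
            exists (hw : all (symunit tauD true) [:: w])
                   (hw' : all (symunit tau1 false) [:: bar w']),
              (partial (witt_cls (diag_form hw))).2 = witt_cls (diag_form hw')]].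
Proof.
move=> x y z pi' bar tauD taux tau0 tau1 nu.
have pi0 := pi_neq0 hpi; have a0 := vunit_neq0 ha.
have xu : x \is a GRing.unit by have /andP[] := quatx_twistable b a0.
have ODq := ODE v_complete k_char ha hb D_division.
have skew_comb (c d e : K) : quat_conj (c *: x + d *: y + e *: z)
    = - (c *: x + d *: y + e *: z).
  by apply: quatP; split=> /=; ring.
have twist_pi : twist_fun tauD pi' =1 taux.
  move=> d; rewrite /taux /= /twist_fun /pi' (pV b ha hpi).
  by rewrite -scalerAr -!scalerAl scalerA mulVf // scale1r.
have bar_y : bar y = quaty _ _ by apply: quatP; rewrite /= vred0 vred1.
have bar_z : bar z = quatz _ _ by apply: quatP; rewrite /= vred0 vred1.
split.
- split=> //; last exact: tau_x_orthogonal (two_neq0 k_char) _.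
  have np : nu pi' = 1 := nu_p v_complete k_char ha hb D_division hpi.
  split.
  + by rewrite scaler_eq0 negb_or pi0 quatx_neq0.
  + by rewrite skewE /pi' quat_conjZ quatx_skew scalerN.
  + by rewrite np.
  move=> d d0; rewrite np.
  have [m em _] := nuD_int v_complete k_char ha hb D_division d0.
  by rewrite /nu em ltr0z ler1z gtz0_ge1.
- split; last 1 first.
  + move=> d; rewrite ODq => hd; split; first exact: qred_conj.
    rewrite twist_pi /taux /tau1 !tau_xE /bar.
    by case/qgeP: hd => *; apply: quatP; rewrite /= vredN.
  + split.
    * split; first by rewrite ODq qge1.
        by move=> d e; rewrite !ODq => hd he; apply: qgeD; rewrite ?qgeN.
      by move=> d e; rewrite !ODq; apply: qgeM.
    * by move=> d e; rewrite !ODq; apply: qredD.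
    * by split; [move=> d e; rewrite !ODq; apply: qredM | exact: qred1].
    * by move=> e; have [d hd <-] := qred_surj e; exists d; rewrite ?ODq.
    by move=> d; rewrite ODq => hd; rewrite qred_eq0 // (mDE v_complete k_char ha hb D_division).
  + exact: residue_division v_complete k_char ha hb D_division.
- have two' := residue_two_neq0 k_char.
  rewrite bar_y bar_z /bar qred_x qred1; split.
  + exact: Sym_tau_span (two_neq0 k_char).
  + exact: Sym_tau_span.
  + exact: Sym_tau_x_span.
have [F [larF bijF uniqF]] := larmour_iso v_complete k_char ha hb D_division hpi.
exists F; split=> //.
- move=> al be ga _ _ _ u /and3P[uu]; rewrite !ODq => hu hV.
  have ub0 : bar u != 0.
    apply: contraTneq (oner_neq0 (quat (vred v a) (vred v b))) => e.
    by rewrite -(qred1 v a b) -(mulVr uu) (qredM ha hb hV hu) -/(bar u) e mulr0 eqxx.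
  have su : all (symunit tauD true) [:: u].
    by rewrite /= andbT; apply/andP; rewrite skewE /u skew_comb.
  have nu0 := nuD_unit v_complete k_char ha hb D_division hu ub0.
  (* a line is its own sum with the empty form *)
  have [|//|hu' [hv' e]] := larF [:: u] [::] su isT.
    by move=> u'; rewrite inE => /eqP ->.
  exists su, hu'; rewrite -[RHS]/((_, witt_cls (diag_form hv')).1) -e.
  congr (F _).1; apply: witt_cls_eq.
  by rewrite iso_clsD diag_nil addr0.
move=> al be ga _ _ _ w w0 nw w'.
have sw : all (symunit tauD true) [:: w].
  by rewrite /= andbT; apply/andP; split; [rewrite skewE skew_comb | exact: D_division].
have np : nu pi' = 1 := nu_p v_complete k_char ha hb D_division hpi.
have [//||hu' [hv' e]] := larF [::] [:: w] isT sw.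
  by move=> u'; rewrite inE => /eqP ->; exact: etrans nw (esym np).
have ew : w' = w * pi'^-1.
  rewrite (pV b ha hpi) quatx_inv // -!scalerAr; congr (_ *: _).
  by apply: quatP; split=> /=; field.
have hw' : all (symunit tau1 false) [:: bar w'] by rewrite ew.
exists sw, hw'; transitivity (witt_cls (diag_form hv')).
  rewrite -[RHS]/((witt_cls (diag_form hu'), _).2) -e.
  congr (F _).2; apply: witt_cls_eq.
  by rewrite iso_clsD diag_nil add0r.
by apply/witt_cls_eq/diag_eq; rewrite /= ew.
Qed.
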